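(* Let $\Delta$ be a triangle that supports the negative curve $C$ defined by the polynomial $1-y$. If the right slope $t$ of $\Delta$ is an integer, then $X=\operatorname{Bl}_e X_\Delta$ is a Mori Dream Space.
   Context: We work over an algebraically closed field $k$ of characteristic zero. Triangles $\Delta$ are rational plane triangles with horizontal base, left edge of slope $s$ and right edge of slope $t$, where $s,t$ are rational and $0<s<t$. $X_\Delta$ is the projective toric surface defined by the normal fan of $\Delta$, $e=(1,1)$ is the identity of its torus $T$, and $E$ is the exceptional curve of $X=\operatorname{Bl}_e X_\Delta$. A negative curve in $X$ is an irreducible curve $C\neq E$ with $C\cdot C\le 0$; the curve defined by an irreducible Laurent polynomial $\xi$ is the strict transform of the closure of the zero locus of $\xi$ in $T$. The triangle $\Delta$ supports the negative curve $C$ defined by $\xi$ if $C$ is a negative curve in $\operatorname{Bl}_eX_\Delta$, the Newton polygon of $\xi$ lies in $\Delta$ (up to translation), and $\Delta$ is the smallest such triangle among those obtained from it by scaling and translation. *)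

(* Defs.v *)
From HB Require Import structures.
From mathcomp Require Import all_boot all_order all_algebra.
From mathcomp Require Import boolp.
From mathcomp Require Import mpoly freeg.

Set Implicit Arguments.
Unset Strict Implicit.
Unset Printing Implicit Defensive.

Import Order.TTheory GRing.Theory Num.Theory.
Local Open Scope ring_scope.

(* The base goes from (tri_x, tri_y) to (tri_x + tri_base, tri_y).  As both
   slopes are positive, the apex lies above and to the right of the base. *)
Record triangle := Triangle {
  tri_x : rat;
  tri_y : rat;
  tri_base : rat;
  left_slope : rat;
  right_slope : rat;
  tri_base_gt0 : 0 < tri_base;
  left_slope_gt0 : 0 < left_slope;
  left_lt_right : left_slope < right_slope }.

Definition in_triangle (D : triangle) (p : rat * rat) : Prop :=
  [/\ tri_y D <= p.2,
      p.2 - tri_y D <= left_slope D * (p.1 - tri_x D)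
    & right_slope D * (p.1 - (tri_x D + tri_base D)) <= p.2 - tri_y D].

(* Primitive inward normals of the base, the left edge and the right edge:
   the rays of the normal fan. *)
Definition normal_fan (D : triangle) (i : 'I_3) : int * int :=
  match val i with
  | 0 => (0, 1)
  | 1 => (numq (left_slope D), - denq (left_slope D))
  | _ => (- numq (right_slope D), denq (right_slope D))
  end.

Definition pairing (u : int * int) (m : 'X_{1..2}) : int :=
  u.1 * (m ord0)%:Z + u.2 * (m ord_max)%:Z.

Definition det2 (u v : int * int) : int := u.1 * v.2 - u.2 * v.1.

Section Blowup.

Variable k : closedFieldType.

(* The coordinate ring of the torus T is the ring of Laurent polynomials in
   x = 'X_0 and y = 'X_1.  A Laurent polynomial is represented, up to a
   monomial (a unit), by an element of k[x,y]. *)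
Local Notation pol := {mpoly k[2]}.
Local Notation ratfun := {fraction pol}.

Definition newton_polygon (p : pol) (a : rat * rat) : Prop :=
  exists2 c : 'X_{1..2} -> rat,
    (forall m, 0 <= c m) /\ \sum_(m <- msupp p) c m = 1 &
    a = (\sum_(m <- msupp p) c m * (m ord0)%:R,
         \sum_(m <- msupp p) c m * (m ord_max)%:R).

Definition irreducible (p : pol) : Prop :=
  [/\ p != 0, p \isn't a GRing.unit
    & forall a b : pol, p = a * b ->
        (a \is a GRing.unit) \/ (b \is a GRing.unit)].

(* An irreducible curve in T has a unique equation that is an irreducible
   element of k[x,y] with leading coefficient 1, other than x and y. *)
Definition is_torus_curve (p : pol) : bool :=
  [&& `[< irreducible p >], mleadc p == 1, p != 'X_ord0 & p != 'X_ord_max].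

Definition torus_curve := {p : pol | is_torus_curve p}.

(* X = Bl_e X_Delta, where X_Delta is the complete toric surface whose fan
   has the three rays spanned by u 0, u 1, u 2 (with u given below), enters
   through its function field k(x,y) and its prime divisors with their orders
   of vanishing.  The prime divisors are the strict transforms of the three
   boundary divisors, the exceptional curve E, and the strict transforms of
   the closures of the curves in T. *)

Definition prime_divisor := ('I_3 + unit + torus_curve)%type.
Definition boundary (i : 'I_3) : prime_divisor := inl (inl i).
Definition exceptional : prime_divisor := inl (inr tt).
Definition closure_of (c : torus_curve) : prime_divisor := inr c.

Definition weil_divisor := {freeg prime_divisor / int}.

(* Orders of vanishing of a nonzero p in k[x,y]; the value at p = 0 is junk. *)

Definition ord_boundary (v : int * int) (p : pol) : int :=
  \big[Num.min/pairing v (mlead p)]_(m <- msupp p) pairing v m.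

(* Multiplicity at e = (1,1), which is the order along E. *)
Definition mult_e (p : pol) : nat :=
  let q := p \mPo [tuple 'X_i + 1 | i < 2] in
  \big[minn/mdeg (mlead q)]_(m <- msupp q) mdeg m.

(* c is not constant, so c ^ n can divide p only if n < msize p. *)
Definition ord_curve (c : torus_curve) (p : pol) : nat :=
  \max_(n < msize p | `[< exists q : pol, p = q * val c ^+ n >]) n.

Variable u : 'I_3 -> int * int.

Definition ord_pol (P : prime_divisor) (p : pol) : int :=
  match P with
  | inl (inl i) => ord_boundary (u i) p
  | inl (inr _) => (mult_e p)%:Z
  | inr c => (ord_curve c p)%:Z
  end.

Definition ord (P : prime_divisor) (f : ratfun) : int :=
  ord_pol P (\n_(repr f)) - ord_pol P (\d_(repr f)).

(* As 0 ~ div(c) on X, the curve defined by c is linearly equivalent to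
   - sum_i ord_(D_i)(c) D_i - mult_e(c) E.  So a Weil divisor D is linearly
   equivalent to sum_i (boundary_coef i D) D_i + (exceptional_coef D) E. *)
Definition boundary_coef (i : 'I_3) (D : weil_divisor) : int :=
  \sum_(P <- dom D) coeff P D *
    match P with
    | inl (inl j) => (i == j)%:Z
    | inl (inr _) => 0
    | inr c => - ord_boundary (u i) (val c)
    end.

Definition exceptional_coef (D : weil_divisor) : int :=
  \sum_(P <- dom D) coeff P D *
    match P with
    | inl (inl _) => 0
    | inl (inr _) => 1
    | inr c => - (mult_e (val c))%:Z
    end.

Definition ray_weight (i : 'I_3) : rat := `|det2 (u (i + 1)) (u (i - 1))|%:~R.

(* D_i . D_j = 1 / |det(u_i, u_j)| for i != j, and the self-intersections
   follow from the relations sum_j <u_j, m> D_j ~ 0: the rays satisfy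
   sum_i w_i u_i = 0 with w = ray_weight, so that D_i / w_i does not depend on
   i up to numerical equivalence. *)
Definition boundary_dot (i j : 'I_3) : rat :=
  ray_weight i * ray_weight j / \prod_l ray_weight l.

(* D_i . E = 0 because e is not on D_i, and E . E = -1. *)
Definition intersection (D D' : weil_divisor) : rat :=
  \sum_i \sum_j (boundary_coef i D)%:~R * (boundary_coef j D')%:~R
                * boundary_dot i j
  - (exceptional_coef D)%:~R * (exceptional_coef D')%:~R.

Definition negative_curve (P : prime_divisor) : Prop :=
  P <> exceptional /\ intersection << P >> << P >> <= 0.

(* H^0(X, O_X(D)) *)
Definition global_section (D : weil_divisor) (f : ratfun) : Prop :=
  f = 0 \/ forall P : prime_divisor, 0 <= ord P f + coeff P D.

Definition differ_by_div (D' D : weil_divisor) (h : ratfun) : Prop :=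
  h != 0 /\ forall P : prime_divisor, coeff P D' = coeff P D + ord P h.

(* The Cox ring is the direct sum of the spaces H^0(X, O_X(D)) over the classes
   [D] in Cl(X).  If D' = D + div(h), then multiplication by h is the
   identification of H^0(X, O_X(D')) with H^0(X, O_X(D)); h is determined by D
   and D' up to a nonzero constant.  Being graded by Cl(X), the Cox ring is a
   finitely generated k-algebra if and only if finitely many homogeneous
   elements s_i in H^0(X, O_X(D_i)) generate it: every H^0(X, O_X(D)) is
   spanned over k by the monomials in the s_i whose degree is the class of D. *)
Definition cox_generated_by
    (n : nat) (D : 'I_n -> weil_divisor) (s : 'I_n -> ratfun) : Prop :=
  (forall i, global_section (D i) (s i)) /\
  forall (D0 : weil_divisor) (f : ratfun), global_section D0 f ->
    exists (N : nat) (a : 'I_N -> k) (e : 'I_N -> 'I_n -> nat)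
           (h : 'I_N -> ratfun),
      (forall j, differ_by_div (\sum_i D i *+ e j i) D0 (h j)) /\
      f = \sum_j tofrac (a j)%:MP * (h j * \prod_i s i ^+ e j i).

(* X is Q-factorial and projective with finitely generated class group, so it
   is a Mori Dream Space if and only if its Cox ring is finitely generated. *)
Definition mori_dream_space : Prop :=
  exists (n : nat) (D : 'I_n -> weil_divisor) (s : 'I_n -> ratfun),
    cox_generated_by D s.

End Blowup.

(* p is the equation c of the curve up to a unit of the Laurent polynomial
   ring; in particular p is irreducible as a Laurent polynomial. *)
Definition defines_curve (k : closedFieldType) (p : {mpoly k[2]})
    (c : torus_curve k) : Prop :=
  exists (a : k) (m : 'X_{1..2}), a != 0 /\ p = a *: ('X_[m] * val c).

(* The Newton polygon of p lies in a translate of r * D. *)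
Definition fits_in_scaled (k : closedFieldType) (p : {mpoly k[2]})
    (r : rat) (D : triangle) : Prop :=
  exists v : rat * rat, forall a : rat * rat, newton_polygon p a ->
    in_triangle D ((a.1 - v.1) / r, (a.2 - v.2) / r).

Definition supports_negative_curve (k : closedFieldType) (D : triangle)
    (p : {mpoly k[2]}) : Prop :=
  [/\ exists2 c : torus_curve k,
        defines_curve p c & negative_curve (normal_fan D) (closure_of c),
      fits_in_scaled p 1 D
    & forall r : rat, 0 < r -> fits_in_scaled p r D -> 1 <= r].

(* Main.v *)
From HB Require Import structures.
Require Import Defs.
From mathcomp Require Import all_boot all_order all_algebra.
From mathcomp Require Import boolp mpoly freeg.
From mathcomp Require Import ring zify.

(* Write the left slope as p/q and put r = q t - p.  For the curve C of 1 - y the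
   condition C . C <= 0 says q/p + q/r <= 1.

   Sections of multiples of the degree of Delta that vanish to the right order
   at e are supported on columns of lattice points; as t is an integer, at most
   K + 1 of the columns have at most K points.  By duality there is therefore a
   section F of a class orthogonal to C that is not divisible by 1 - y: its
   restriction to C is c (x - 1)^m.

   To a Laurent polynomial f in a graded piece of the Cox ring attach its class
   together with the lexicographically smallest exponent (c, i) of z^c x^i in
   f(x, 1 + z).  Up to translation these data fill a semigroup contained in a
   simplicial cone of dimension 4, whose four rays are occupied by the section
   of E, by 1 - y, by the section of the base and by F.  By Dickson's lemma the
   semigroup is finitely generated as a module over the semigroup spanned by
   these four, and subtracting monomials with the same lowest term (a SAGBI
   reduction, which terminates as c and i are bounded on a graded piece) shows
   that the Cox ring is finitely generated. *)

(** A class with a lowest exponent consists of six integers, the three [a i], [mu], [c] and [i];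
    modulo monomials four remain, hence the dimension of the cone. The pair [(c, i)] is a rank two
    valuation: the order along C, where z = 0, then the order at x = 0 of the leading coefficient.
    The facets come from one principle: a polynomial in one variable divisible by (X - 1)^n has two
    exponents at distance at least n. In y it makes the columns high, in x it makes the support
    wide. Three of the rays are occupied by obvious sections. The section F must have degree 0 on C
    without vanishing on C, and its existence is where C . C <= 0 and the integrality of t are
    spent. Put m = q (p + r). In characteristic zero, F vanishes to order m at e once its
    coefficients, as weights on the lattice points (x, y), have zero moments x^i y^j for i + j < m.
    Such weights with nonzero moment x^m exist unless some polynomial x^m + (terms of degree below
    m) vanishes at all lattice points of the triangle; counting columns excludes this. *)

Set Implicit Arguments.
Unset Strict Implicit.
Unset Printing Implicit Defensive.

Import Order.TTheory GRing.Theory Num.Theory.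
Local Open Scope ring_scope.

(** * Irreducible elements of k[x][y] are prime *)

Section Gauss.

Variable k : closedFieldType.
Local Notation bipoly := {poly {poly k}}.

Definition is_const (p : bipoly) : Prop := exists c : k, p = c%:P%:P.

Definition birreducible (p : bipoly) : Prop :=
  [/\ p != 0, ~ is_const p
    & forall a b : bipoly, p = a * b -> is_const a \/ is_const b].

(** Peeling off linear factors of elements of k[x] one at a time reduces Gauss's lemma to evaluation
    at a root, without contents. *)
Lemma closed_poly_ind (P : {poly k} -> Prop) :
  (forall a : k, a != 0 -> P a%:P) ->
  (forall (r : k) (c : {poly k}), c != 0 -> P c -> P (('X - r%:P) * c)) ->
  forall c : {poly k}, c != 0 -> P c.
Proof.
move=> PC PX c; have [s ->] := closed_field_poly_normal c.
rewrite scaler_eq0 negb_or lead_coef_eq0 => /andP[c0 _].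
elim: s => [|r s IHs]; first by rewrite big_nil -mul_polyC mulr1; apply: PC; rewrite lead_coef_eq0.
rewrite big_cons scalerAr; apply: PX => //.
by rewrite scaler_eq0 lead_coef_eq0 negb_or c0 monic_neq0 // monic_prod_XsubC.
Qed.

Lemma scale_bipolyI (c : {poly k}) :
  c != 0 -> injective (fun p : bipoly => c *: p).
Proof.
move=> c0 p q; rewrite -!mul_polyC; apply: mulfI; by rewrite polyC_eq0.
Qed.

Lemma eval_eq0_dvd (r : k) (q : bipoly) :
  map_poly (horner_eval r) q = 0 -> exists q' : bipoly, q = ('X - r%:P) *: q'.
Proof.
move=> q0; exists (map_poly (fun c => c %/ ('X - r%:P)) q).
apply/polyP => j; rewrite coefZ coef_map_id0 ?div0p // mulrC divpK //.
rewrite dvdp_XsubCl; apply/eqP.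
by have := congr1 (fun p : {poly k} => p`_j) q0; rewrite coef_map coef0.
Qed.

Lemma eval_XsubC_scale (r : k) (q : bipoly) :
  map_poly (horner_eval r) (('X - r%:P) *: q) = 0.
Proof. by rewrite -mul_polyC rmorphM /= map_polyC /= /horner_eval !hornerE subrr mul0r. Qed.

Lemma XsubC_not_const (r : k) : ~ is_const ('X - r%:P)%:P.
Proof.
move=> [c /polyC_inj /(congr1 (fun p : {poly k} => size p))].
by rewrite size_XsubC size_polyC; case: eqP.
Qed.

Lemma birreducible_eval (p : bipoly) (r : k) :
  birreducible p -> (1 < size p)%N -> map_poly (horner_eval r) p != 0.
Proof.
move=> [_ _ irrp] sp; apply/eqP => /eval_eq0_dvd[p' def_p].
rewrite -mul_polyC in def_p.
case: (irrp _ _ def_p) => [/XsubC_not_const //|[c def_p']].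
move: sp; rewrite def_p def_p' -polyCM size_polyC; by case: (_ != _).
Qed.

(** An irreducible [p] of positive degree in y is not divisible by any ['X - r%:P], so every linear
    factor of [c] divides [g] and cancels. *)
Lemma birreducible_cancel (p b g : bipoly) (c : {poly k}) :
    birreducible p -> (1 < size p)%N -> c != 0 -> c *: b = p * g ->
  exists g' : bipoly, b = p * g'.
Proof.
move=> irrp sp c0; move: c c0 b g; apply: closed_poly_ind => [a a0|r c c0 IH] b g def_b.
  exists (a^-1%:P *: g); rewrite -scalerAr -def_b scalerA -polyCM mulVf //.
  by rewrite scale1r.
have /eqP : map_poly (horner_eval r) p * map_poly (horner_eval r) g = 0.
  by rewrite -rmorphM /= -def_b -scalerA eval_XsubC_scale.
rewrite mulf_eq0 (negPf (birreducible_eval _ _ _)) //= => /eqP/eval_eq0_dvd[g' def_g].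
apply: (IH b g'); apply: (@scale_bipolyI ('X - r%:P)); rewrite ?polyXsubC_eq0 //.
by rewrite scalerA def_b def_g -scalerAr.
Qed.

(** Each linear factor of [c] divides [g] or [h]; [e] collects those taken from [g]. *)
Lemma gauss_split (p g h : bipoly) (c : {poly k}) : c != 0 -> c *: p = g * h ->
  exists (g' h' : bipoly) (e : {poly k}), [/\ p = g' * h', e != 0 & g = e *: g'].
Proof.
move=> c0; move: c c0 g h; apply: closed_poly_ind => [a a0|r c c0 IH] g h def_p.
  exists g, (a^-1%:P *: h), 1; rewrite oner_eq0 scale1r; split=> //.
  by rewrite -scalerAr -def_p scalerA -polyCM mulVf // scale1r.
have r0 : 'X - r%:P != 0 by rewrite polyXsubC_eq0.
have /eqP : map_poly (horner_eval r) g * map_poly (horner_eval r) h = 0.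
  by rewrite -rmorphM /= -def_p -scalerA eval_XsubC_scale.
rewrite mulf_eq0 => /orP[] /eqP/eval_eq0_dvd[g' def_g].
  have [|g1 [h1 [e [def_p1 e0 def_g']]]] := IH g' h.
    by apply: (scale_bipolyI r0); rewrite scalerA def_p def_g -scalerAl.
  exists g1, h1, (('X - r%:P) * e); split; rewrite ?mulf_neq0 //.
  by rewrite def_g def_g' scalerA.
apply: (IH g g'); apply: (scale_bipolyI r0).
by rewrite scalerA def_p def_g -scalerAr.
Qed.

(** If [p] has degree 0 in y, it is a constant times a linear polynomial in x, and evaluation at the
    root decides. Otherwise let [d] be a gcd of [p] and [a] over the fraction field of k[x], with
    denominators cleared. If [d] has degree 0 in y, Bezout shows that [p] divides a k[x]-multiple of
    [b]; if not, [gauss_split] makes [p] a constant times a factor of [d]. *)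
Lemma birreducible_prime (p a b g : bipoly) :
    birreducible p -> a * b = p * g ->
  (exists x : bipoly, a = p * x) \/ (exists x : bipoly, b = p * x).
Proof.
move=> irrp def_ab; have [p0 pnc fact_p] := irrp.
have [sp|sp] := leqP (size p) 1.
  have [pi def_p] : exists pi : {poly k}, p = pi%:P by exists p`_0; exact: size1_polyC.
  have spi : size pi != 1.
    apply/eqP => /eqP/size_poly1P[c _ def_pi]; apply: pnc; exists c.
    by rewrite def_p def_pi.
  have [r /factor_theorem[pi' def_pi]] := closed_rootP pi spi.
  rewrite mulrC in def_pi.
  have [/XsubC_not_const //|[c def_pi']] : is_const ('X - r%:P)%:P \/ is_const pi'%:P.
    by apply: fact_p; rewrite -polyCM -def_pi.
  have c0 : c != 0.
    apply/eqP => c0; move: p0; rewrite def_p def_pi polyCM def_pi' c0 !polyC0.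
    by rewrite mulr0 eqxx.
  have pE q : p * (c^-1%:P *: q) = ('X - r%:P) *: q.
    rewrite def_p def_pi polyCM def_pi' -!mul_polyC.
    transitivity ((c * c^-1)%:P%:P * (('X - r%:P)%:P * q)).
      by rewrite polyCM [X in _ = X * _]polyCM; ring.
    by rewrite mulfV // mul1r.
  have /eqP : map_poly (horner_eval r) a * map_poly (horner_eval r) b = 0.
    by rewrite -rmorphM def_ab rmorphM def_p def_pi /= map_polyC /= /horner_eval !hornerE
       subrr !mul0r.
  rewrite mulf_eq0 => /orP[] /eqP/eval_eq0_dvd[q ->]; [left|right];
    by exists (c^-1%:P *: q); rewrite pE.
have [[u v] /= bez] := Pdiv.Idomain.Bezoutp p a.
set d := Pdiv.Idomain.gcdp p a in bez.
have d0 : d != 0 by rewrite Pdiv.Idomain.gcdp_eq0 negb_and p0.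
have w0 : u * p + v * a != 0.
  by rewrite -size_poly_eq0 (Pdiv.Idomain.eqp_size bez) size_poly_eq0.
move/Pdiv.Idomain.eqp_eq: bez => bez.
have [sd|sd] := leqP (size d) 1.
  right; have [c def_d] : exists c : {poly k}, d = c%:P by exists d`_0; exact: size1_polyC.
  apply: (@birreducible_cancel p b (lead_coef d *: (u * b + v * g))
            (lead_coef (u * p + v * a) * c)) => //.
    by rewrite mulf_neq0 ?lead_coef_eq0 // -polyC_eq0 -def_d.
  transitivity (lead_coef (u * p + v * a) *: d * b).
    by rewrite def_d -!mul_polyC polyCM.
  rewrite -bez -!mul_polyC.
  transitivity ((lead_coef d)%:P * (u * p * b + v * (a * b))); first by ring.
  by rewrite def_ab; ring.
left.
have [/= [c p1] /= c0 def_p] := Pdiv.Idomain.dvdpP _ _ (Pdiv.Idomain.dvdp_gcdl p a).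
have [/= [c' a1] /= c'0 def_a] := Pdiv.Idomain.dvdpP _ _ (Pdiv.Idomain.dvdp_gcdr p a).
rewrite -/d in def_p def_a; rewrite mulrC in def_p.
have [d' [p' [e [def_p' e0 def_d]]]] := gauss_split c0 def_p.
have [[z def_d']|[z def_z]] := fact_p _ _ def_p'.
  by move: sd; rewrite def_d def_d' -mul_polyC -polyCM size_polyC; case: (_ != _).
have z0 : z != 0.
  by apply/eqP => z0; move: p0; rewrite def_p' def_z z0 !polyC0 mulr0 eqxx.
apply: (@birreducible_cancel p a (z^-1%:P *: (e *: a1)) c') => //.
rewrite def_a def_d def_p' def_z -!mul_polyC.
transitivity ((z^-1%:P * z%:P)%:P * (a1 * (e%:P * d'))); last by rewrite polyCM; ring.
by rewrite -polyCM mulVf // mul1r.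
Qed.

End Gauss.

(** * k[x,y] as k[x][y] *)

Section Bivariate.

Variable k : closedFieldType.
Local Notation pol := {mpoly k[2]}.
Local Notation bipoly := {poly {poly k}}.

Definition mon2 (i j : nat) : 'X_{1..2} :=
  [multinom if l == ord0 then i else j | l < 2].

Lemma mon2_0 i j : mon2 i j ord0 = i.
Proof. by rewrite mnmE. Qed.

Lemma mon2_1 i j : mon2 i j ord_max = j.
Proof. by rewrite mnmE. Qed.

Lemma ord2P (l : 'I_2) : l = ord0 \/ l = ord_max.
Proof. by case: l => [[|[|l]] //= i]; [left|right]; apply: val_inj. Qed.

Lemma mon2P (m m' : 'X_{1..2}) :
  m ord0 = m' ord0 -> m ord_max = m' ord_max -> m = m'.
Proof. by move=> e0 e1; apply/mnmP => l; case: (ord2P l) => ->. Qed.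

Lemma mon2E (m : 'X_{1..2}) : m = mon2 (m ord0) (m ord_max).
Proof. by apply: mon2P; rewrite ?mon2_0 ?mon2_1. Qed.

Definition psi_var (l : 'I_2) : bipoly := if l == ord0 then 'X%:P else 'X.

(* [k[x,y] = k[x][y]] *)
Definition psi : pol -> bipoly := mmap (polyC \o polyC) psi_var.
HB.instance Definition _ := GRing.RMorphism.on psi.

Lemma psiX m : psi 'X_[m] = ('X^(m ord0))%:P * 'X^(m ord_max).
Proof.
rewrite /psi mmapX /mmap1 big_ord_recl big_ord1 /psi_var /= polyC_exp.
by congr (_ * _ ^+ m _); apply: val_inj.
Qed.

Lemma psiC (c : k) : psi c%:MP = c%:P%:P.
Proof. by rewrite /psi mmapC. Qed.

Lemma psiZ (c : k) p : psi (c *: p) = c%:P%:P * psi p.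
Proof. by rewrite /psi mmapZ. Qed.

Lemma coef_psi p i j : (psi p)`_j`_i = p@_(mon2 i j).
Proof.
rewrite {1}[p]mpolyE rmorph_sum /= [in RHS](mpolyE p) raddf_sum coef_sum coef_sum /=.
apply: eq_bigr => m _; rewrite psiZ psiX mcoeffZ mcoeffX mulrA -polyCM coefCM coefXn.
case: (eqVneq j (m ord_max)) => [->|nj].
  rewrite mulr1 coefCM coefXn; congr (_ * _%:R).
  case: (eqVneq i (m ord0)) => [->|ni]; first by rewrite -mon2E eqxx.
  by case: eqP => // e; rewrite e mon2_0 eqxx in ni.
rewrite mulr0 coef0; case: eqP => [e|]; last by rewrite mulr0.
by rewrite e mon2_1 eqxx in nj.
Qed.

Lemma psi_inj : injective psi.
Proof. by move=> p q e; apply/mpolyP => m; rewrite [m]mon2E -!coef_psi e. Qed.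

Lemma psi_eq0 p : (psi p == 0) = (p == 0).
Proof. by rewrite -(rmorph0 psi) (inj_eq psi_inj). Qed.

Lemma psi_surj (q : bipoly) : exists p, psi p = q.
Proof.
exists (\sum_(j < size q) \sum_(i < size q`_j) q`_j`_i *: 'X_[mon2 i j]).
rewrite rmorph_sum /=.
rewrite -[RHS]coefK poly_def; apply: eq_bigr => j _.
rewrite rmorph_sum -mul_polyC -[in RHS](coefK q`_j) poly_def rmorph_sum mulr_suml.
by apply: eq_bigr => i _ /=; rewrite psiZ psiX mon2_0 mon2_1 -mul_polyC polyCM mulrA.
Qed.

Lemma unit_psi p : p != 0 -> is_const (psi p) <-> p \is a GRing.unit.
Proof.
move=> p0; split.
  move=> [c def_c]; have def_p : p = c%:MP by apply: psi_inj; rewrite def_c psiC.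
  have c0 : c != 0 by move: p0; rewrite def_p mpolyC_eq0.
  by rewrite def_p; apply: rmorph_unit; rewrite unitfE.
by rewrite unfold_in => /andP[/eqP -> _]; exists p@_0; rewrite psiC.
Qed.

Definition divides (a b : pol) : Prop := exists q : pol, b = q * a.

Lemma curve_prime (c : torus_curve k) (a b : pol) :
  divides (val c) (a * b) -> divides (val c) a \/ divides (val c) b.
Proof.
have /and4P[/asboolP[c0 c_nu irr] _ _ _] := valP c.
move=> [g def_ab].
have irrc : birreducible (psi (val c)).
  split; first by rewrite psi_eq0.
    by move/(unit_psi c0); apply/negP.
  move=> a' b'; have [a1 <-] := psi_surj a'; have [b1 <-] := psi_surj b'.
  rewrite -rmorphM => /psi_inj e; move: c0; rewrite e mulf_eq0 negb_or => /andP[a0 b0].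
  by rewrite !unit_psi //; apply: irr.
have [|[x]|[x]] := @birreducible_prime _ (psi (val c)) (psi a) (psi b) (psi g) irrc.
- by rewrite -!rmorphM def_ab mulrC.
- have [y <-] := psi_surj x; rewrite -rmorphM => /psi_inj ->.
  by left; exists y; rewrite mulrC.
- have [y <-] := psi_surj x; rewrite -rmorphM => /psi_inj ->.
  by right; exists y; rewrite mulrC.
Qed.

End Bivariate.

(** * Orders along the boundary and along E *)

Section MonomialWeights.

Variables (k : closedFieldType) (w : 'X_{1..2} -> int).
Hypothesis wD : {morph w : m m' / (m + m')%MM >-> m + m'}.
Local Notation pol := {mpoly k[2]}.

(** A common form of [ord_boundary], with weight [pairing v], and of [mult_e], with the total degree
    as weight after e is moved to the origin. *)
Definition min_weight (p : pol) : int :=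
  \big[Num.min/w (mlead p)]_(m <- msupp p) w m.

Lemma min_weight_le (p : pol) m : m \in msupp p -> min_weight p <= w m.
Proof. by move=> mp; apply: ge_bigmin_seq. Qed.

Lemma le_min_weight (p : pol) b : p != 0 ->
  (forall m, m \in msupp p -> b <= w m) -> b <= min_weight p.
Proof.
move=> p0 le_b; rewrite /min_weight big_seq; apply: le_bigmin => //.
by apply: le_b; apply: mlead_supp.
Qed.

Lemma min_weight_attained (p : pol) : p != 0 ->
  exists2 m, m \in msupp p & w m = min_weight p.
Proof.
move=> p0; apply: contrapT => no_m.
suff: min_weight p + 1 <= min_weight p by rewrite gerDl.
apply: le_min_weight => // m mp; rewrite lezD1 lt_neqAle min_weight_le // andbT.
by apply/eqP => e; apply: no_m; exists m.
Qed.

Definition initial_form (e : int) (p : pol) : pol :=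
  \sum_(m <- msupp p) (if w m == e then p@_m else 0) *: 'X_[m].

Lemma mcoeff_initial_form e p m :
  (initial_form e p)@_m = if w m == e then p@_m else 0.
Proof.
rewrite /initial_form raddf_sum /=.
have [mp|mp] := boolP (m \in msupp p); last first.
  rewrite (memN_msupp_eq0 mp) if_same big_seq big1 // => m' m'p.
  rewrite mcoeffZ mcoeffX; case: (m' =P m) => [e'|]; last by rewrite mulr0.
  by rewrite -e' m'p in mp.
rewrite (bigD1_seq m) //= ?msupp_uniq // mcoeffZ mcoeffX eqxx mulr1 big1 ?addr0 //.
by move=> m' /negPf nm; rewrite mcoeffZ mcoeffX nm mulr0.
Qed.

Lemma mcoeffM_initial (p q : pol) e e' m :
    (forall m, m \in msupp p -> e <= w m) ->
    (forall m, m \in msupp q -> e' <= w m) -> w m = e + e' ->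
  (p * q)@_m = (initial_form e p * initial_form e' q)@_m.
Proof.
move=> le_e le_e' wm; rewrite !mcoeffM; apply: eq_bigr => -[k1 k2] /= /eqP def_m.
rewrite !mcoeff_initial_form.
have {}wm : w k1 + w k2 = e + e' by rewrite -wD -def_m.
have [p1|p1] := boolP (bmnm k1 \in msupp p); last first.
  by rewrite (memN_msupp_eq0 p1) if_same !mul0r.
have [q2|q2] := boolP (bmnm k2 \in msupp q); last first.
  by rewrite (memN_msupp_eq0 q2) if_same !mulr0.
have := le_e _ p1; have := le_e' _ q2 => l1 l2.
have -> : w k1 = e by lia.
have -> : w k2 = e' by lia.
by rewrite !eqxx.
Qed.

(** The initial forms have a nonzero product because polynomials form a domain, so the lowest weight
    does not cancel. *)
Lemma min_weightM (p q : pol) : p != 0 -> q != 0 ->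
  min_weight (p * q) = min_weight p + min_weight q.
Proof.
move=> p0 q0; apply/eqP; rewrite eq_le; apply/andP; split; last first.
  apply: le_min_weight => [|m /msuppM_le/allpairsP[[m1 m2] /= [p1 q2 ->]]].
    by rewrite mulf_neq0.
  by rewrite wD lerD // min_weight_le.
have ini0 (r : pol) : r != 0 -> initial_form (min_weight r) r != 0.
  move=> r0; have [m mr wm] := min_weight_attained r0.
  apply/eqP => /(congr1 (mcoeff m)); rewrite mcoeff_initial_form wm eqxx mcoeff0.
  by apply/eqP; rewrite -mcoeff_msupp.
set r := initial_form (min_weight p) p * initial_form (min_weight q) q.
have r0 : r != 0 by rewrite mulf_neq0 ?ini0.
have rm := mlead_supp r0; have /msuppM_le/allpairsP[[m1 m2] /= [p1 q2 def_m]] := rm.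
have wm1 : w m1 = min_weight p.
  by move: p1; rewrite mcoeff_msupp mcoeff_initial_form; case: ifP => [/eqP|]; rewrite ?eqxx.
have wm2 : w m2 = min_weight q.
  by move: q2; rewrite mcoeff_msupp mcoeff_initial_form; case: ifP => [/eqP|]; rewrite ?eqxx.
have wm : w (mlead r) = min_weight p + min_weight q by rewrite def_m wD wm1 wm2.
rewrite -wm; apply: min_weight_le.
rewrite mcoeff_msupp (@mcoeffM_initial p q _ _ _ (@min_weight_le p) (@min_weight_le q) wm).
by rewrite -mcoeff_msupp.
Qed.

Lemma min_weightX m : min_weight 'X_[m] = w m.
Proof. by rewrite /min_weight msuppX big_cons big_nil mleadXm minxx. Qed.

Lemma min_weightC (c : k) : c != 0 -> min_weight c%:MP = 0.
Proof.
move=> c0; rewrite /min_weight msuppC (negPf c0) big_cons big_nil mleadC minxx.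
by apply: (@addrI _ (w 0%MM)); rewrite -wD addm0 addr0.
Qed.

End MonomialWeights.

(** * Multiplicity at e in terms of f(x, 1 + z) *)

Section Orders.

Variable k : closedFieldType.
Local Notation pol := {mpoly k[2]}.

Lemma pairingD v : {morph pairing v : m m' / (m + m')%MM >-> m + m'}.
Proof. by move=> m m'; rewrite /pairing !mnmDE !PoszD; ring. Qed.

Lemma ord_boundaryM v (p q : pol) : p != 0 -> q != 0 ->
  ord_boundary v (p * q) = ord_boundary v p + ord_boundary v q.
Proof. exact: (min_weightM (pairingD v)). Qed.

Definition shift_e : pol -> pol := comp_mpoly [tuple 'X_i + 1 | i < 2].
HB.instance Definition _ := GRing.RMorphism.on shift_e.

(* [f(x, 1 + z)] *)
Definition phi : pol -> {poly {poly k}} := comp_poly ('X + 1) \o @psi k.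
HB.instance Definition _ := GRing.RMorphism.on phi.

Lemma eq_mpoly_rmorph (S : comNzRingType) (f g : {rmorphism pol -> S}) :
    (forall c : k, f c%:MP = g c%:MP) -> (forall i, f 'X_i = g 'X_i) ->
  f =1 g.
Proof.
move=> eqC eqX p; rewrite [p]mpolyE !rmorph_sum; apply: eq_bigr => m _.
rewrite -!mul_mpolyC !rmorphM /= eqC mpolyXE_id !rmorph_prod; congr (_ * _).
by apply: eq_bigr => i _; rewrite !rmorphXn /= eqX.
Qed.

Lemma psiXU (i : 'I_2) : @psi k 'X_i = psi_var k i.
Proof. by rewrite /psi mmapX mmap1U. Qed.

(** The translation of e to the origin splits into y -> 1 + z, which is [phi], and x -> 1 + x in
    each coefficient. Thus multiplicities at e are read off from the expansion that also defines
    lowest terms. *)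
Lemma psi_shift_e (p : pol) :
  psi (shift_e p) = map_poly (comp_poly ('X + 1)) (phi p).
Proof.
pose f1 : {rmorphism pol -> {poly {poly k}}} := @psi k \o shift_e.
pose f2 : {rmorphism pol -> {poly {poly k}}} := map_poly (comp_poly ('X + 1)) \o phi.
apply: (@eq_mpoly_rmorph _ f1 f2) => [c|i] /=.
  by rewrite /shift_e comp_mpolyC /phi /= psiC comp_polyC map_polyC /= comp_polyC.
rewrite /shift_e comp_mpolyXU -tnth_nth tnth_mktuple rmorphD rmorph1 /= /phi /= psiXU.
rewrite /psi_var; case: ifP => _.
  by rewrite comp_polyC map_polyC /= comp_polyX polyCD.
by rewrite comp_polyX rmorphD rmorph1 /= map_polyX.
Qed.

Lemma comp_polyXD1_eq0 (S : comNzRingType) (p : {poly S}) :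
  (p \Po ('X + 1) == 0) = (p == 0).
Proof.
apply/eqP/eqP => [e|->]; last by rewrite comp_poly0.
have := congr1 (comp_poly ('X - 1)) e; rewrite /= -comp_polyA comp_polyD comp_polyX.
by rewrite comp_polyC subrK comp_polyXr comp_poly0.
Qed.

Lemma phi_eq0 (p : pol) : (phi p == 0) = (p == 0).
Proof. by rewrite comp_polyXD1_eq0 psi_eq0. Qed.

Lemma coef_shift_e (p : pol) i c :
  (shift_e p)@_(mon2 i c) = ((phi p)`_c \Po ('X + 1))`_i.
Proof. by rewrite -coef_psi psi_shift_e coef_map. Qed.

Lemma shift_e_eq0 (p : pol) : (shift_e p == 0) = (p == 0).
Proof.
apply/eqP/eqP => [e|->]; last by rewrite rmorph0.
apply/eqP; rewrite -phi_eq0; apply/eqP/polyP => c; apply/eqP.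
rewrite coef0 -comp_polyXD1_eq0; apply/eqP/polyP => i.
by rewrite -coef_shift_e e mcoeff0 coef0.
Qed.

Lemma mult_e_weight (p : pol) :
  (mult_e p)%:Z = min_weight (fun m => (mdeg m)%:Z) (shift_e p).
Proof.
rewrite /mult_e /min_weight; apply: (big_morph Posz) => // m n.
by rewrite /minn /Order.min ltz_nat; case: ifP.
Qed.

Lemma mdeg2 (m : 'X_{1..2}) : mdeg m = (m ord0 + m ord_max)%N.
Proof.
rewrite mdegE big_ord_recl big_ord1; congr (_ + m _)%N; exact: val_inj.
Qed.

Lemma mult_eM (p q : pol) : p != 0 -> q != 0 ->
  mult_e (p * q) = (mult_e p + mult_e q)%N.
Proof.
move=> p0 q0; apply/eqP; rewrite -eqz_nat PoszD !mult_e_weight.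
by rewrite rmorphM min_weightM ?shift_e_eq0 // => m m'; rewrite mdegD PoszD.
Qed.

Lemma coef_mult_e (p : pol) i c : (i + c < mult_e p)%N ->
  ((phi p)`_c \Po ('X + 1))`_i = 0.
Proof.
rewrite -coef_shift_e -ltz_nat mult_e_weight => lt_ic.
apply: memN_msupp_eq0; apply: contraL lt_ic => ms; rewrite -leNgt.
by apply: le_trans (min_weight_le _ ms) _; rewrite mdeg2 mon2_0 mon2_1.
Qed.

Lemma le_mult_e (p : pol) n : p != 0 ->
  (forall i c, (i + c < n)%N -> ((phi p)`_c \Po ('X + 1))`_i = 0) ->
  (n <= mult_e p)%N.
Proof.
move=> p0 zero; rewrite -lez_nat mult_e_weight; apply: le_min_weight.
  by rewrite shift_e_eq0.
move=> m; rewrite mcoeff_msupp [m]mon2E coef_shift_e mdeg2 mon2_0 mon2_1.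
by rewrite lez_nat leqNgt; apply: contra => /zero ->.
Qed.

Lemma mult_e_unit (p : pol) : ((phi p)`_0).[1] != 0 -> mult_e p = 0%N.
Proof.
rewrite -(add0r 1); apply: contraNeq; rewrite -lt0n => /(@coef_mult_e p 0 0).
by rewrite -horner_coef0 horner_comp !hornerE => ->.
Qed.

Lemma mult_eX m : mult_e ('X_[m] : pol) = 0%N.
Proof.
apply: mult_e_unit; rewrite /phi /= psiX rmorphM /= comp_polyC comp_Xn_poly coefCM.
rewrite hornerM hornerXn expr1n mul1r -horner_coef0 horner_exp !hornerE expr1n.
by rewrite ?hornerE oner_neq0.
Qed.

Lemma mult_eC (c : k) : c != 0 -> mult_e (c%:MP : pol) = 0%N.
Proof.
by move=> c0; apply: mult_e_unit; rewrite /phi /= psiC comp_polyC coefC hornerC.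
Qed.

End Orders.

(** * Orders along curves and orders of fractions *)

Section CurveOrder.

Variable k : closedFieldType.
Local Notation pol := {mpoly k[2]}.

Lemma curve_neq0 (c : torus_curve k) : val c != 0.
Proof. by have /and4P[/asboolP[]] := valP c. Qed.

Lemma curve_msize (c : torus_curve k) : (1 < msize (val c))%N.
Proof.
have /and4P[/asboolP[c0 c_nu _] _ _ _] := valP c.
rewrite ltnNge; apply: contraNN c_nu => /msize1_polyC def_c.
have := c0; rewrite def_c mpolyC_eq0 => d0.
by apply: rmorph_unit; rewrite unitfE.
Qed.

Lemma msizeMS (a b : pol) : a != 0 -> b != 0 ->
  [/\ (0 < msize a)%N, (0 < msize b)%N & (msize (a * b)).+1 = (msize a + msize b)%N].
Proof.
move=> a0 b0; rewrite msizeM // !lt0n !msize_poly_eq0; split=> //.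
rewrite prednK // addn_gt0 lt0n; by rewrite msize_poly_eq0 a0.
Qed.

Lemma msize_exp_gt (c : pol) n : (1 < msize c)%N -> (n < msize (c ^+ n))%N.
Proof.
move=> sc; have c0 : c != 0 by rewrite -msize_poly_eq0 -lt0n ltnW.
elim: n => [|n IH]; first by rewrite expr0 msize1.
have [_ _] := msizeMS c0 (expf_neq0 n c0); rewrite -exprS.
move: (msize (c ^+ n)) (msize (c ^+ n.+1)) (msize c) IH sc; lia.
Qed.

Lemma divides_trans (a b c : pol) : divides a b -> divides b c -> divides a c.
Proof. by move=> [x ->] [y ->]; exists (y * x); rewrite mulrA. Qed.

Lemma divides_exp (a : pol) n n' : (n <= n')%N -> divides (a ^+ n) (a ^+ n').
Proof. by move=> le_n; exists (a ^+ (n' - n)); rewrite -exprD subnK. Qed.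

Lemma ord_curve_divides (c : torus_curve k) (p : pol) n : p != 0 ->
  (n <= ord_curve c p)%N <-> divides (val c ^+ n) p.
Proof.
move=> p0; split => [le_n|div_n].
  apply: (divides_trans (divides_exp _ le_n)).
  have sp : (0 < msize p)%N by rewrite lt0n msize_poly_eq0.
  rewrite /ord_curve (bigop.bigmax_eq_arg (Ordinal sp)) /=; last first.
    by apply/asboolP; exists p; rewrite expr0 mulr1.
  by case: arg_maxnP => [|i /asboolP //]; apply/asboolP; exists p; rewrite expr0 mulr1.
have lt_n : (n < msize p)%N.
  case: div_n p0 => [q ->]; rewrite mulf_eq0 negb_or => /andP[q0 c0].
  have [] := msizeMS q0 c0; have := msize_exp_gt n (curve_msize c).
  move: (msize (q * _)) (msize q) (msize (_ ^+ n)); lia.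
by apply: (@leq_bigmax_cond _ _ _ (Ordinal lt_n)); apply/asboolP.
Qed.

Lemma ord_curve_split (c : torus_curve k) (p : pol) : p != 0 ->
  exists2 a, p = a * val c ^+ ord_curve c p & ~ divides (val c) a.
Proof.
move=> p0; have [a def_p] := (ord_curve_divides c (ord_curve c p) p0).1 (leqnn _).
exists a => // -[b def_a].
have /(ord_curve_divides c _ p0) : divides (val c ^+ (ord_curve c p).+1) p.
  by exists b; rewrite {1}def_p def_a exprS mulrA.
by rewrite ltnn.
Qed.

Lemma ord_curve_eq (c : torus_curve k) (p a : pol) n : p != 0 ->
  p = a * val c ^+ n -> ~ divides (val c) a -> ord_curve c p = n.
Proof.
move=> p0 def_p ndiv; apply/eqP; rewrite eqn_leq andbC.
rewrite (ord_curve_divides c n p0).2; last by exists a.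
rewrite leqNgt; apply/negP => /(ord_curve_divides c _ p0)[b].
rewrite {1}def_p exprS mulrA => /mulIf e; apply: ndiv; exists b; apply: e.
by rewrite expf_neq0 ?curve_neq0.
Qed.

Lemma ord_curveM (c : torus_curve k) (p q : pol) : p != 0 -> q != 0 ->
  ord_curve c (p * q) = (ord_curve c p + ord_curve c q)%N.
Proof.
move=> p0 q0; have [a def_p na] := ord_curve_split c p0.
have [b def_q nb] := ord_curve_split c q0.
apply: (@ord_curve_eq _ _ (a * b)); first by rewrite mulf_neq0.
  by rewrite {1}def_p {1}def_q exprD mulrACA.
by move/curve_prime => -[].
Qed.

Lemma ord_curve_ndiv (c : torus_curve k) (p : pol) :
  p != 0 -> ~ divides (val c) p -> ord_curve c p = 0%N.
Proof. by move=> p0; apply: ord_curve_eq; rewrite ?expr0 ?mulr1. Qed.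

Lemma curve_ndivC (c : torus_curve k) (a : k) : a != 0 -> ~ divides (val c) a%:MP.
Proof.
move=> a0 [q def_a]; have := msizeC 2 a; rewrite def_a a0 /=.
have q0 : q != 0.
  by apply: contraNneq a0 => q0; rewrite -(mpolyC_eq0 2) def_a q0 mul0r.
have [] := msizeMS q0 (curve_neq0 c); have := curve_msize c.
move: (msize (q * _)) (msize q) (msize (val c)); lia.
Qed.

Lemma curve_div_irr (c : torus_curve k) (p : pol) :
  irreducible p -> divides (val c) p -> exists2 a : k, a != 0 & p = a *: val c.
Proof.
have /and4P[/asboolP[c0 c_nu _] _ _ _] := valP c.
move=> [p0 p_nu irr] [q def_p]; case: (irr _ _ def_p) => [|cu]; last by rewrite cu in c_nu.
rewrite unfold_in => /andP[/eqP def_q]; rewrite unitfE => q0.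
by exists q@_0 => //; rewrite -mul_mpolyC -def_q.
Qed.

Lemma curve_mleadcZ (c : torus_curve k) (a : k) : a != 0 -> mleadc (a *: val c) = a.
Proof.
have /and4P[_ /eqP l _ _] := valP c.
by move=> a0; rewrite mleadZ_proper ?mcoeffZ l mulr1.
Qed.

Lemma ord_curve_curve (c c' : torus_curve k) : ord_curve c (val c') = (c == c').
Proof.
have [<-|ne_c] := eqVneq c c'.
  apply: (@ord_curve_eq _ _ 1); rewrite ?curve_neq0 ?expr1 ?mul1r //.
  by rewrite -mpolyC1; apply: curve_ndivC; rewrite oner_neq0.
apply: ord_curve_ndiv; rewrite ?curve_neq0 // => div_c.
have /and4P[/asboolP irr' /eqP l' _ _] := valP c'.
have [a a0 def_c'] := curve_div_irr irr' div_c.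
case/eqP: ne_c; apply: val_inj; move: l'; rewrite def_c' curve_mleadcZ // => ->.
by rewrite scale1r.
Qed.

Lemma irreducibleXU (i : 'I_2) : irreducible ('X_i : pol).
Proof.
split.
- by rewrite -msize_poly_eq0 msizeX.
- by apply/negP => /andP[_]; rewrite mcoeffX mnm1_eq0 unitr0.
move=> a b def_X.
have : a * b != 0 by rewrite -def_X -msize_poly_eq0 msizeX.
rewrite mulf_eq0 negb_or => /andP[a0 b0].
have := congr1 (fun p : pol => msize p) def_X; rewrite msizeX mdeg1 => sz.
have [] := msizeMS a0 b0; rewrite -sz.
have unitP (p : pol) : p != 0 -> (msize p <= 1)%N -> p \is a GRing.unit.
  move=> p0 /msize1_polyC def_p; have := p0; rewrite def_p mpolyC_eq0 => c0.
  by apply: rmorph_unit; rewrite unitfE.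
move: (unitP a a0) (unitP b b0); move: (msize a) (msize b) => sa sb ua ub sa0 sb0 sab.
by have [sa1|sa1] := leqP sa 1; [left; apply: ua|right; apply: ub]; lia.
Qed.

Lemma curve_ndivX (c : torus_curve k) m : ~ divides (val c) 'X_[m].
Proof.
have nU i : ~ divides (val c) 'X_i.
  move=> /(curve_div_irr (irreducibleXU i))[a a0 def_X].
  have /and4P[_ /eqP l n0 n1] := valP c.
  have : mleadc ('X_i : pol) = 1 by rewrite mleadXm mcoeffX eqxx.
  rewrite {1 2}def_X curve_mleadcZ // => a1.
  have e : val c = 'X_i by rewrite def_X a1 scale1r.
  by case: (ord2P i) => ei; move: n0 n1; rewrite e ei eqxx.
have nE i n : ~ divides (val c) ('X_i ^+ n).
  elim: n => [|n IH]; last by rewrite exprS => /curve_prime[/nU|/IH].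
  by rewrite expr0 -mpolyC1; apply: curve_ndivC; rewrite oner_neq0.
rewrite mpolyXE_id big_ord_recl big_ord1.
by move=> /curve_prime[] /nE.
Qed.

End CurveOrder.

Section FractionOrder.

Variables (k : closedFieldType) (u : 'I_3 -> int * int).
Local Notation pol := {mpoly k[2]}.
Local Notation ratfun := {fraction pol}.
Local Notation "x %:F" := (tofrac x).
Implicit Type P : prime_divisor k.

Lemma ord_polM P (p q : pol) : p != 0 -> q != 0 ->
  ord_pol u P (p * q) = ord_pol u P p + ord_pol u P q.
Proof.
move=> p0 q0; case: P => [[i|_]|c] /=; first exact: ord_boundaryM.
  by rewrite mult_eM.
by rewrite ord_curveM.
Qed.

Lemma ord_polC P (a : k) : a != 0 -> ord_pol u P a%:MP = 0.
Proof.
move=> a0; case: P => [[i|_]|c] /=; first exact: (min_weightC (pairingD _)).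
  by rewrite mult_eC.
by rewrite ord_curve_ndiv ?mpolyC_eq0 //; apply: curve_ndivC.
Qed.

Definition ord_mon (P : prime_divisor k) (m : 'X_{1..2}) : int :=
  if P is inl (inl i) then pairing (u i) m else 0.

Lemma ord_polX P m : ord_pol u P ('X_[m] : pol) = ord_mon P m.
Proof.
case: P => [[i|_]|c] /=; first exact: min_weightX.
  by rewrite mult_eX.
rewrite ord_curve_ndiv //; first by rewrite -msize_poly_eq0 msizeX.
exact: curve_ndivX.
Qed.

Lemma frac_repr (f : ratfun) : f * (\d_(repr f))%:F = (\n_(repr f))%:F.
Proof.
rewrite -{1}[f]reprK; move: (repr f) => x; unlock FracField.tofrac.
rewrite -[LHS]FracField.pi_mul; apply/eqmodP; rewrite /= FracField.equivfE.
rewrite /FracField.mulf !numden_Ratio ?(oner_neq0, mulf_neq0, denom_ratioP) //.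
by rewrite !mulr1 mulrC.
Qed.

(** The order is defined through the chosen representative [repr f]; additivity on polynomials makes
    it independent of that choice. *)
Lemma ord_frac P (a b : pol) : a != 0 -> b != 0 ->
  ord u P (a%:F / b%:F) = ord_pol u P a - ord_pol u P b.
Proof.
move=> a0 b0; rewrite /ord; set f := _ / _; have := frac_repr f.
have d0 := denom_ratioP (repr f); have f0 : f != 0 by rewrite mulf_neq0 ?invr_eq0 ?tofrac_eq0.
move=> def_n; have n0 : \n_(repr f) != 0.
  by rewrite -tofrac_eq0 -def_n mulf_neq0 ?tofrac_eq0.
have /eqP : a%:F * (\d_(repr f))%:F = (\n_(repr f))%:F * b%:F.
  by rewrite -def_n /f [RHS]mulrAC divfK ?tofrac_eq0.
rewrite -!rmorphM tofrac_eq => /eqP /(congr1 (ord_pol u P)); rewrite !ord_polM //.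
by move=> e; apply/eqP; rewrite subr_eq addrAC eq_sym subr_eq e.
Qed.

Lemma frac_split (f : ratfun) : f != 0 ->
  exists a b : pol, [/\ a != 0, b != 0 & f = a%:F / b%:F].
Proof.
move=> f0; exists \n_(repr f), \d_(repr f); have d0 := denom_ratioP (repr f).
split=> //; last by rewrite -frac_repr mulfK ?tofrac_eq0.
by rewrite -tofrac_eq0 -frac_repr mulf_neq0 ?tofrac_eq0.
Qed.

Lemma ordM P (f g : ratfun) : f != 0 -> g != 0 ->
  ord u P (f * g) = ord u P f + ord u P g.
Proof.
move=> /frac_split[a [b [a0 b0 ->]]] /frac_split[c [d [c0 d0 ->]]].
by rewrite mulf_div -!rmorphM /= !ord_frac ?mulf_neq0 // !ord_polM // opprD addrACA.
Qed.

Lemma ord_tofrac P (p : pol) : p != 0 -> ord u P p%:F = ord_pol u P p.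
Proof.
move=> p0; rewrite -[p%:F]divr1 -(rmorph1 (@tofrac _)) ord_frac ?oner_neq0 //.
by rewrite -mpolyC1 ord_polC ?oner_neq0 // subr0.
Qed.

Lemma ord1 P : ord u P 1 = 0.
Proof.
by rewrite -(rmorph1 (@tofrac _)) ord_tofrac ?oner_neq0 // -mpolyC1 ord_polC ?oner_neq0.
Qed.

Lemma ordV P (f : ratfun) : f != 0 -> ord u P f^-1 = - ord u P f.
Proof.
move=> f0; apply/eqP; rewrite -addr_eq0 -ordM ?invr_eq0 // mulVf //.
by apply/eqP; exact: ord1.
Qed.

End FractionOrder.

(** * Reduction to Laurent polynomials *)

Section Factorization.

Variable k : closedFieldType.
Local Notation pol := {mpoly k[2]}.

(** Existence of factorizations as an induction principle: up to a constant, an irreducible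
    polynomial is a variable or the equation of a torus curve. *)
Lemma pol_mul_ind (P : pol -> Prop) :
    P 1 -> (forall (a : k) x, a != 0 -> P x -> P (a%:MP * x)) ->
    (forall i x, P x -> P ('X_i * x)) ->
    (forall (c : torus_curve k) x, P x -> P (val c * x)) ->
  forall b : pol, b != 0 -> P b.
Proof.
move=> P1 PC PX Pc b b0; rewrite -[b]mulr1.
(* The cofactor [x] is carried along so that, for reducible [d], the two factors can be multiplied
   onto it one after the other. *)
suff IH n (d x : pol) : (msize d <= n)%N -> d != 0 -> P x -> P (d * x) by apply: IH.
elim: n d x => [|n IHn] d x sd d0 Px.
  by rewrite leqn0 msize_poly_eq0 (negPf d0) in sd.
have [d_u|d_nu] := boolP (d \is a GRing.unit).
  have := d_u => /andP[/eqP -> _]; apply: PC Px.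
  by case/andP: d_u => _; rewrite unitfE.
have [irr_d|nirr_d] := pselect (irreducible d).
  have l0 : mleadc d != 0 by rewrite mleadc_eq0.
  pose d1 := (mleadc d)^-1 *: d.
  have def_d : d * x = d1 * ((mleadc d)%:MP * x).
    by rewrite /d1 mulrA -[d1 * _]mulrC mul_mpolyC scalerA mulfV // scale1r.
  have Px1 := PC _ _ l0 Px.
  have [d1X|d1X0] := eqVneq d1 'X_ord0; first by rewrite def_d d1X; apply: PX.
  have [d1X'|d1X1] := eqVneq d1 'X_ord_max; first by rewrite def_d d1X'; apply: PX.
  have d1c : is_torus_curve d1.
    apply/and4P; split; [|by rewrite mleadZ_proper ?mcoeffZ mulVf ?oner_neq0|exact: d1X0|exact: d1X1].
    apply/asboolP; have [_ _ irr] := irr_d; split.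
    - by rewrite scaler_eq0 invr_eq0 negb_or l0.
    - apply: contraNN d_nu => d1u.
      have -> : d = (mleadc d)%:MP * d1 by rewrite mul_mpolyC scalerA mulfV // scale1r.
      by rewrite unitrM d1u rmorph_unit // unitfE.
    move=> a1 b1 def_d1; have := irr ((mleadc d)%:MP * a1) b1.
    rewrite -mulrA -def_d1 mul_mpolyC scalerA mulfV // scale1r => /(_ erefl).
    by rewrite unitrM => -[/andP[_ ?]|?]; [left|right].
  by rewrite def_d; apply: (Pc (exist _ d1 d1c)).
have [a [b' [def_d a_nu b_nu]]] :
    exists a b', [/\ d = a * b', a \isn't a GRing.unit & b' \isn't a GRing.unit].
  apply: contrapT => no; apply: nirr_d; split=> // a b' def_d.
  have [|a_nu] := boolP (a \is a GRing.unit); first by left.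
  have [|b_nu] := boolP (b' \is a GRing.unit); first by right.
  by case: no; exists a, b'.
have := d0; rewrite def_d mulf_eq0 negb_or => /andP[a0 b'0].
have nu_size (e : pol) : e != 0 -> e \isn't a GRing.unit -> (1 < msize e)%N.
  move=> e0; rewrite ltnNge; apply: contraNN => /msize1_polyC def_e.
  by rewrite def_e rmorph_unit // unitfE; rewrite def_e mpolyC_eq0 in e0.
have sa := nu_size _ a0 a_nu; have sb := nu_size _ b'0 b_nu.
have [_ _] := msizeMS a0 b'0; rewrite -def_d => sab.
have [sa' sb'] : (msize a <= n /\ msize b' <= n)%N.
  by move: (msize a) (msize b') (msize d) sa sb sab sd => ? ? ?; lia.
by rewrite def_d -mulrA; apply: (IHn) => //; apply: IHn.
Qed.

(** By induction on the factors of [b]: a curve factor also divides [a] and is cancelled, while a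
    variable is a unit on T and goes into the monomial. *)
Lemma curves_divide_laurent (b a : pol) : b != 0 -> a != 0 ->
    (forall c : torus_curve k, (ord_curve c b <= ord_curve c a)%N) ->
  exists (p : pol) m, a * 'X_[m] = p * b.
Proof.
move=> b0; suff : b != 0 /\ forall a : pol, a != 0 ->
    (forall c : torus_curve k, (ord_curve c b <= ord_curve c a)%N) ->
  exists (p : pol) m, a * 'X_[m] = p * b by case=> _ /(_ a).
move: b b0 {a}; apply: pol_mul_ind => [|d x d0 [x0 IH]|i x [x0 IH]|c x [x0 IH]].
- by split=> [|a a0 _]; rewrite ?oner_neq0 //; exists a, 0%MM; rewrite mpolyX0.
- split=> [|a a0 le_c]; first by rewrite mulf_neq0 ?mpolyC_eq0.
  have [|p [m e]] := IH a a0.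
    move=> c; apply: leq_trans (le_c c); rewrite ord_curveM ?mpolyC_eq0 //.
    exact: leq_addl.
  exists (d^-1%:MP * p), m; rewrite e.
  transitivity ((d^-1 * d)%:MP * (p * x)); first by rewrite mulVf ?mpolyC1 ?mul1r.
  by rewrite mpolyCM; ring.
- have X0 : 'X_i != 0 :> pol by rewrite -msize_poly_eq0 msizeX.
  split=> [|a a0 le_c]; first by rewrite mulf_neq0.
  have [|p [m e]] := IH a a0.
    by move=> c; apply: leq_trans (le_c c); rewrite ord_curveM // leq_addl.
  by exists p, (m + U_(i))%MM; rewrite mpolyXD mulrA e; ring.
split=> [|a a0 le_c]; first by rewrite mulf_neq0 // curve_neq0.
have [a' def_a] : divides (val c) a.
  rewrite -[val c]expr1; apply/ord_curve_divides => //; apply: leq_trans (le_c c).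
  by rewrite ord_curveM ?curve_neq0 // ord_curve_curve eqxx leq_addr.
have := a0; rewrite def_a mulf_eq0 negb_or => /andP[a'0 c0].
have [|p [m e]] := IH a' a'0.
  move=> c'; have := le_c c'; rewrite def_a !ord_curveM //; lia.
by exists p, m; rewrite mulrAC e; ring.
Qed.

End Factorization.

Section LaurentReduction.

Variables (k : closedFieldType) (u : 'I_3 -> int * int).
Local Notation pol := {mpoly k[2]}.
Local Notation ratfun := {fraction pol}.
Local Notation "x %:F" := (tofrac x).
Implicit Type P : prime_divisor k.

Lemma ordXz P (f : ratfun) (z : int) : f != 0 -> ord u P (f ^ z) = z * ord u P f.
Proof.
move=> f0; have ordX (g : ratfun) n : g != 0 -> ord u P (g ^+ n) = n%:Z * ord u P g.
  move=> g0; elim: n => [|n IH]; first by rewrite expr0 ord1 mul0r.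
  by rewrite exprS ordM ?expf_neq0 // IH intS mulrDl mul1r.
case: z => n; first exact: ordX.
by rewrite NegzE -exprnN ordV ?expf_neq0 // ordX // mulNr.
Qed.

(** Every curve in T has an equation, so the part of [D] inside T is principal; [H] is the product
    of the equations with the coefficients of [D] as exponents. *)
Lemma exists_curve_part (D : weil_divisor k) :
  exists2 H : ratfun, H != 0 &
    forall c : torus_curve k, ord u (closure_of c) H = coeff (closure_of c) D.
Proof.
have [H H0 ordH] : exists2 H : ratfun, H != 0 & forall c : torus_curve k,
    ord u (closure_of c) H
    = \sum_(Q <- dom D) coeff Q D * (Q == closure_of c)%:R.
  elim: (dom D) => [|Q s [H H0 ordH]].
    by exists 1 => [|c]; rewrite ?oner_neq0 // big_nil ord1.
  case: Q => [b|c']; first exists H => // c; first by rewrite big_cons /= mulr0 add0r.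
  have c'0 : (val c')%:F != 0 :> ratfun by rewrite tofrac_eq0 curve_neq0.
  exists ((val c')%:F ^ coeff (inr c') D * H) => [|c].
    exact: mulf_neq0 (expfz_neq0 _ c'0) H0.
  rewrite big_cons (ordM _ _ (expfz_neq0 _ c'0) H0) (ordXz _ _ c'0) ordH.
  congr (_ * _ + _).
  rewrite ord_tofrac ?curve_neq0 // [LHS]/= ord_curve_curve eq_sym.
  by case e: (c' == c); rewrite [X in _ = (nat_of_bool X)%:R]e.
exists H => // c; rewrite ordH -[in RHS](freeg_sumE D) raddf_sum.
by apply: eq_bigr => Q _; rewrite /= coeffU.
Qed.

(* The global sections of [sum_i a_i D_i - mu E] are Laurent polynomials; those
   that are polynomials satisfy [laurent_section a mu] below. *)
Definition laurent_divisor (a : 'I_3 -> int) (mu : int) : weil_divisor k :=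
  \sum_i << a i *g boundary k i >> - << mu *g exceptional k >>.

Lemma coeff_laurent_boundary a mu i : coeff (boundary k i) (laurent_divisor a mu) = a i.
Proof.
rewrite coeffB coeffU mulr0 subr0 raddf_sum (bigD1 i) //= coeffU eqxx mulr1.
rewrite big1 ?addr0 // => j /negPf nj; rewrite coeffU.
by rewrite (_ : (_ == _) = (j == i)) // nj mulr0.
Qed.

Lemma coeff_laurent_exceptional a mu :
  coeff (exceptional k) (laurent_divisor a mu) = - mu.
Proof.
rewrite coeffB coeffU eqxx mulr1 raddf_sum big1 ?add0r // => j _.
by rewrite /= coeffU mulr0.
Qed.

Lemma coeff_laurent_curve a mu c : coeff (closure_of c) (laurent_divisor a mu) = 0.
Proof.
rewrite coeffB coeffU mulr0 subr0 raddf_sum big1 // => j _.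
by rewrite /= coeffU mulr0.
Qed.

Definition laurent_section (a : 'I_3 -> int) (mu : int) (p : pol) : Prop :=
  [/\ p != 0, forall i, 0 <= ord_boundary (u i) p + a i & mu <= (mult_e p)%:Z].

Lemma laurent_global_section a mu p :
  laurent_section a mu p -> global_section u (laurent_divisor a mu) p%:F.
Proof.
move=> [p0 ap mp]; right=> -[[i|[]]|c]; rewrite ord_tofrac //.
- by rewrite coeff_laurent_boundary; apply: ap.
- by rewrite coeff_laurent_exceptional subr_ge0.
by rewrite coeff_laurent_curve addr0.
Qed.

Variables (n : nat) (D : 'I_n -> weil_divisor k) (s : 'I_n -> ratfun).

Definition cox_span (D0 : weil_divisor k) (f : ratfun) : Prop :=
  exists (N : nat) (a : 'I_N -> k) (e : 'I_N -> 'I_n -> nat) (h : 'I_N -> ratfun),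
    (forall j, differ_by_div u (\sum_i D i *+ e j i) D0 (h j)) /\
    f = \sum_j tofrac (a j)%:MP * (h j * \prod_i s i ^+ e j i).

Lemma cox_span0 D0 : cox_span D0 0.
Proof. by exists 0, (fun=> 0), (fun _ _ => 0%N), (fun=> 0); split=> [[]|] //; rewrite big_ord0. Qed.

Lemma cox_spanD D0 f g : cox_span D0 f -> cox_span D0 g -> cox_span D0 (f + g).
Proof.
move=> [N [a [e [h [de ->]]]]] [N' [a' [e' [h' [de' ->]]]]].
pose cat (T : Type) (x : 'I_N -> T) (x' : 'I_N' -> T) (j : 'I_(N + N')) :=
  match split j with inl i => x i | inr i => x' i end.
exists (N + N')%N, (cat _ a a'), (cat _ e e'), (cat _ h h'); split.
  by move=> j; rewrite /cat; case: (split j).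
have catl T (x : 'I_N -> T) x' j : cat T x x' (lshift N' j) = x j.
  by rewrite /cat (unsplitK (inl _ j)).
have catr T (x : 'I_N -> T) x' j : cat T x x' (rshift N j) = x' j.
  by rewrite /cat (unsplitK (inr _ j)).
by rewrite big_split_ord /=; congr (_ + _); apply: eq_bigr => j _; rewrite !(catl, catr).
Qed.

Lemma cox_span_monomial D0 (a : k) (e : 'I_n -> nat) h :
    differ_by_div u (\sum_i D i *+ e i) D0 h ->
  cox_span D0 (a%:MP%:F * (h * \prod_i s i ^+ e i)).
Proof.
move=> de; exists 1%N, (fun=> a), (fun=> e), (fun=> h); split=> //.
by rewrite big_ord1.
Qed.

Lemma cox_span_shift D0 D0' (H f : ratfun) : H != 0 ->
    (forall P, coeff P D0' = coeff P D0 - ord u P H) ->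
  cox_span D0' (f * H) -> cox_span D0 f.
Proof.
move=> H0 eD [N [a [e [h [de def_f]]]]].
exists N, a, e, (fun j => h j / H); split=> [j|].
  have [h0 eh] := de j; have V0 : H^-1 != 0 := etrans (congr1 negb (invr_eq0 H)) H0.
  split; first exact: mulf_neq0 h0 V0.
  move=> P; rewrite eh eD (ordM _ _ h0 V0) (ordV _ _ H0) addrAC.
  exact: esym (addrA _ _ _).
rewrite -[f](mulfK H0) def_f mulr_suml; apply: eq_bigr => j _.
by rewrite -!mulrA; congr (_ * (_ * _)); rewrite mulrC.
Qed.

(** Multiplication by [H] removes the curve components from the divisor. The section becomes regular
    on T, hence a Laurent polynomial, and a further monomial factor makes it a polynomial. *)
Lemma cox_generated_by_laurent :
    (forall i, global_section u (D i) (s i)) ->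
    (forall a mu p, laurent_section a mu p -> cox_span (laurent_divisor a mu) p%:F) ->
  cox_generated_by u D s.
Proof.
move=> secs span; split=> // D0 f [->|f_sec]; first exact: cox_span0.
have [f0|f0] := eqVneq f 0; first by rewrite f0; exact: cox_span0.
have [H H0 ordH] := exists_curve_part D0.
have [x [y [x0 y0 def_fH]]] : exists x y : pol, [/\ x != 0, y != 0 & f * H = x%:F / y%:F].
  exact: frac_split (mulf_neq0 f0 H0).
have [|p [m pxy]] := @curves_divide_laurent _ y x y0 x0.
  move=> c; have := f_sec (closure_of c); rewrite -ordH -(ordM _ _ f0 H0) def_fH (ord_frac _ _ x0 y0) /=.
  by rewrite subr_ge0.
have X0 : 'X_[m] != 0 :> pol by rewrite -msize_poly_eq0 msizeX.
have p0 : p != 0.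
  by have := mulf_neq0 x0 X0; rewrite pxy mulf_eq0 negb_or => /andP[].
pose H' := H * 'X_[m]%:F.
have XF0 : 'X_[m]%:F != 0 :> ratfun by rewrite tofrac_eq0.
have H'0 : H' != 0 by exact: mulf_neq0 H0 XF0.
have def_p : f * H' = p%:F.
  have yF0 : y%:F != 0 :> ratfun by rewrite tofrac_eq0.
  have eF : x%:F * 'X_[m]%:F = p%:F * y%:F by rewrite -tofracM pxy tofracM.
  rewrite /H' mulrA def_fH mulrAC eF; exact: mulfK.
pose a i := coeff (boundary k i) D0 - ord u (boundary k i) H'.
pose mu := - (coeff (exceptional k) D0 - ord u (exceptional k) H').
have eD P : coeff P (laurent_divisor a mu) = coeff P D0 - ord u P H'.
  case: P => [[i|[]]|c].
  - exact: coeff_laurent_boundary.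
  - by rewrite coeff_laurent_exceptional opprK.
  rewrite coeff_laurent_curve (ordM _ _ H0 XF0) ordH (ord_tofrac _ _ X0) ord_polX.
  by rewrite /= addr0 subrr.
apply: (cox_span_shift H'0 eD); rewrite def_p; apply: span.
have sec P : 0 <= ord_pol u P p + coeff P (laurent_divisor a mu).
  rewrite eD -(ord_tofrac _ _ p0) -def_p (ordM _ _ f0 H'0) addrACA subrr addr0.
  exact: f_sec.
split=> // [i|]; first by have := sec (boundary k i); rewrite coeff_laurent_boundary.
by have := sec (exceptional k); rewrite coeff_laurent_exceptional /= subr_ge0.
Qed.

End LaurentReduction.

(** * Lowest terms *)

Section LowestTerm.

Variable k : closedFieldType.
Local Notation pol := {mpoly k[2]}.
Local Notation bipoly := {poly {poly k}}.

Lemma lowest_split (S : idomainType) (P : {poly S}) : P != 0 ->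
  exists (n : nat) (a : S) (R : {poly S}), a != 0 /\ P = 'X^n * (a%:P + 'X * R).
Proof.
elim/poly_ind: P => [|P a IH]; first by rewrite eqxx.
have [->|a0 _] := eqVneq a 0; last first.
  by exists 0%N, a, P; rewrite expr0 mul1r addrC ['X * P]mulrC.
rewrite polyC0 addr0; have [->|/IH[n [b [R [b0 ->]]]] _] := eqVneq P 0.
  by rewrite mul0r eqxx.
by exists n.+1, b, R; rewrite exprSr -mulrA mulrCA mulrC.
Qed.

(* [(c, i)] is the lexicographically smallest exponent of [z^c x^i] in
   [f(x, 1 + z)], and [l] its coefficient (when [l != 0]). *)
Definition lowest_term (f : pol) (c i : nat) (l : k) : Prop :=
  exists (v : {poly k}) (R : bipoly),
    phi f = 'X^c * (('X^i * v)%:P + 'X * R) /\ v.[0] = l.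

Lemma lowest_term_exists (f : pol) : f != 0 ->
  exists c i l, l != 0 /\ lowest_term f c i l.
Proof.
rewrite -phi_eq0 => /lowest_split[c [a [R [/lowest_split[i [l [r [l0 ->]]]] ef]]]].
exists c, i, l; split=> //; exists (l%:P + 'X * r), R; split=> //.
by rewrite !hornerE ?mul0r ?addr0.
Qed.

Lemma lowest_termP (f : pol) c i l : lowest_term f c i l ->
  [/\ forall j, (j < c)%N -> (phi f)`_j = 0,
      forall j, (j < i)%N -> (phi f)`_c`_j = 0
    & (phi f)`_c`_i = l].
Proof.
move=> [v [R [-> <-]]].
have -> : ('X^c * (('X^i * v)%:P + 'X * R))`_c = 'X^i * v.
  by rewrite coefXnM ltnn subnn coefD coefC coefXM addr0.
split=> [j lt_j|j lt_j|]; rewrite coefXnM ?lt_j //.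
by rewrite ltnn subnn horner_coef0.
Qed.

Lemma lowest_termM (f g : pol) c d i j l m :
  lowest_term f c i l -> lowest_term g d j m ->
  lowest_term (f * g) (c + d) (i + j) (l * m).
Proof.
move=> [v [R [ef <-]]] [w [Q [eg <-]]].
exists (v * w), (('X^i * v)%:P * Q + ('X^j * w)%:P * R + 'X * (R * Q)).
rewrite rmorphM /= ef eg hornerM; split=> //.
rewrite !exprD -mulrACA; congr (_ * _); rewrite mulrACA polyCM.
by rewrite mulrDl !mulrDr; ring.
Qed.

Lemma lowest_termC (a : k) : lowest_term a%:MP 0 0 a.
Proof.
exists a%:P, 0; rewrite /phi /= psiC comp_polyC !expr0 !mul1r mulr0 addr0.
by rewrite hornerC.
Qed.

Lemma lowest_term1 : lowest_term (1 : pol) 0 0 1.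
Proof. by rewrite -mpolyC1; apply: lowest_termC. Qed.

Lemma lowest_term_mon (m : 'X_{1..2}) : lowest_term ('X_[m] : pol) 0 (m ord0) 1.
Proof.
have [R eR] : exists R : bipoly, ('X + 1) ^+ m ord_max = 1 + 'X * R.
  elim: (m ord_max) => [|n [R eR]]; first by exists 0; rewrite expr0 mulr0 addr0.
  by exists (1 + 'X * R + R); rewrite exprS eR; ring.
exists 1, (('X^(m ord0))%:P * R); rewrite hornerC; split=> //.
rewrite /phi /= psiX rmorphM /= comp_polyC comp_Xn_poly eR expr0 mul1r mulr1.
by rewrite mulrDr mulr1 mulrCA.
Qed.

Lemma lowest_termB (f g : pol) c i l : lowest_term f c i l -> lowest_term g c i l ->
    f - g != 0 ->
  exists c' i' l', [/\ l' != 0, lowest_term (f - g) c' i' l'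
    & (c < c')%N \/ c' = c /\ (i < i')%N].
Proof.
move=> /lowest_termP[f1 f2 f3] /lowest_termP[g1 g2 g3] fg0.
have [c' [i' [l' [l'0 lt]]]] := lowest_term_exists fg0.
exists c', i', l'; split=> //; have [_ _ e] := lowest_termP lt.
move: e; rewrite raddfB coefB => e.
have [lt_c|lt_c|e_c] := ltngtP c c'; [by left| |right].
  by move: l'0; rewrite -e f1 // g1 // subr0 coef0 eqxx.
split=> //; rewrite ltnNge leq_eqVlt; apply/negP => /orP[/eqP e_i|lt_i].
  by move: l'0; rewrite -e -e_c e_i coefB f3 g3 subrr eqxx.
by move: l'0; rewrite -e -e_c coefB f2 // g2 // subrr eqxx.
Qed.

Lemma coef_XD1_exp (S : comNzRingType) n j :
  (('X + 1 : {poly S}) ^+ n)`_j = 'C(n, j)%:R.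
Proof.
rewrite addrC exprDn coef_sum; under eq_bigr do rewrite expr1n mul1r coefMn coefXn.
have [le_j|lt_j] := leqP j n.
  rewrite (bigD1 (inord j)) //= inordK // eqxx big1 ?addr0 // => l ne_l.
  by case: eqP => [e|]; rewrite ?mul0rn //; rewrite e inord_val eqxx in ne_l.
rewrite bin_small // big1 // => l _; case: eqP => [e|]; last by rewrite mul0rn.
by move: lt_j; rewrite e ltnNge -ltnS ltn_ord.
Qed.

Lemma coef_phi (f : pol) j i :
  (phi f)`_j`_i = \sum_(y < size (psi f)) (psi f)`_y`_i *+ 'C(y, j).
Proof.
rewrite /phi /= comp_polyE coef_sum coef_sum; apply: eq_bigr => y _.
by rewrite coefZ coef_XD1_exp mulr_natr coefMn.
Qed.

(* The hypothesis says that [(X - 1)^c] divides [P]. *)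
Lemma width_vanishing (P : {poly k}) c : P != 0 ->
    (forall j, (j < c)%N -> (P \Po ('X + 1))`_j = 0) ->
  exists y1 y2, [/\ (y1 + c <= y2)%N, P`_y1 != 0 & P`_y2 != 0].
Proof.
move=> P0 zero; have [y1 [a [R [a0 def_P]]]] := lowest_split P0.
pose Q := a%:P + 'X * R.
have Q0 : Q != 0 by move: P0; rewrite def_P mulf_eq0 negb_or => /andP[].
have divP : ('X - 1) ^+ c %| P.
  have -> : P = (drop_poly c (P \Po ('X + 1)) \Po ('X - 1)) * ('X - 1) ^+ c.
    rewrite -comp_Xn_poly -comp_polyM -[LHS]comp_polyXr.
    have {1}-> : 'X = ('X + 1 : {poly k}) \Po ('X - 1).
      by rewrite comp_polyD comp_polyX comp_polyC subrK.
    rewrite comp_polyA; congr (_ \Po _).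
    rewrite -{1}[P \Po _](poly_take_drop c) [take_poly _ _](_ : _ = 0) ?add0r //.
    by apply/polyP => j; rewrite coef_take_poly coef0; case: ifP => // /zero.
  exact: dvdp_mull.
(* Coprimality moves the factor ('X - 1)^c to [Q], which has a nonzero constant term and therefore
   degree at least [c]. *)
have cop : coprimep (('X - 1) ^+ c) ('X^y1 : {poly k}).
  apply/coprimep_expl/coprimep_expr; rewrite -[1]polyC1 coprimep_sym coprimep_XsubC.
  by rewrite rootE hornerX oner_neq0.
have : ('X - 1) ^+ c %| Q by rewrite -(Gauss_dvdpr _ cop) -def_P.
move/(dvdp_leq Q0); rewrite -[1]polyC1 size_exp_XsubC => sQ.
exists y1, (y1 + (size Q).-1)%N; split; first by rewrite leq_add2l; lia.
  by rewrite def_P coefXnM ltnn subnn coefD coefC coefXM addr0.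
by rewrite def_P -/Q coefXnM ltnNge leq_addr addKn -lead_coefE lead_coef_eq0.
Qed.

End LowestTerm.

(** * The cone of classes and lowest terms *)

Section Bounds.

Variables (k : closedFieldType) (p q t : int).
Local Notation pol := {mpoly k[2]}.

Definition o0 : 'I_3 := Ordinal (isT : 0 < 3)%N.
Definition o1 : 'I_3 := Ordinal (isT : 1 < 3)%N.
Definition o2 : 'I_3 := Ordinal (isT : 2 < 3)%N.

Lemma ord3P (i : 'I_3) : [\/ i = o0, i = o1 | i = o2].
Proof.
case: i => [[|[|[|i]]] //= lt_i];
  [constructor 1|constructor 2|constructor 3]; exact: val_inj.
Qed.

Definition tri_fan (i : 'I_3) : int * int :=
  match val i with
  | 0 => (0, 1)
  | 1 => (p, - q)
  | _ => (- t, 1)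
  end.

(* With the linear form [c], the facets of the simplicial cone; all four are
   invariant under multiplication by monomials. *)
Definition form2 (a : 'I_3 -> int) (c i : nat) : int :=
  p * i%:Z + q * a o0 + a o1 - q * c%:Z.
Definition form3 (a : 'I_3 -> int) (c i : nat) : int :=
  a o1 + q * a o2 - (q * t - p) * i%:Z - q * c%:Z.
Definition form4 (a : 'I_3 -> int) (mu : int) (c i : nat) : int :=
  a o1 + q * a o2 - (q * t - p) * (i%:Z + mu - c%:Z) - q * c%:Z.

Hypotheses (q_gt0 : 0 < q) (r_gt0 : 0 < q * t - p).

(** The terms of [f] with x-exponent [i] form a polynomial in y divisible by (y - 1)^c, so this
    column contains two support points at distance at least [c]. The lower one obeys the
    inequalities of the base and of the right edge, the upper one that of the left edge. *)
Lemma column_bounds a mu (f : pol) c i : laurent_section tri_fan a mu f ->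
    (forall j, (j < c)%N -> (phi f)`_j`_i = 0) -> (phi f)`_c`_i != 0 ->
  0 <= form2 a c i /\ 0 <= form3 a c i.
Proof.
move=> [f0 fa _] zero nz.
pose C := \poly_(y < size (psi f)) (psi f)`_y`_i.
have coefC y : C`_y = f@_(mon2 i y).
  by rewrite coef_poly -coef_psi; case: ltnP => // ?; rewrite [(psi f)`_y]nth_default ?coef0.
have compC j : (C \Po ('X + 1))`_j = (phi f)`_j`_i.
  rewrite coef_phi /C poly_def rmorph_sum coef_sum; apply: eq_bigr => y _.
  by rewrite /= comp_polyZ comp_Xn_poly coefZ coef_XD1_exp mulr_natr.
have C0 : C != 0.
  by apply: contraNneq nz => C0; rewrite -compC C0 comp_poly0 coef0.
have [|y1 [y2 [le_y y1C y2C]]] := @width_vanishing _ C c C0.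
  by move=> j lt_j; rewrite compC zero.
have ge l y : C`_y != 0 -> 0 <= pairing (tri_fan l) (mon2 i y) + a l.
  rewrite coefC -mcoeff_msupp => fy; apply: le_trans (fa l) _.
  by rewrite lerD2r; apply: (@min_weight_le _ (pairing (tri_fan l)) f).
have := ge o0 _ y1C; have := ge o2 _ y1C; have := ge o1 _ y2C.
rewrite /form2 /form3 /pairing /tri_fan /= !mon2_0 !mon2_1.
move=> g1 g2 g0; have {}le_y : 0 <= y2%:Z - y1%:Z - c%:Z by lia.
split; [|]; nia.
Qed.

(** For [form4]: the coefficient [G] of z^c starts at x^i and is divisible by (x - 1)^(mu - c) when
    mu > c, so it has an exponent of at least i + mu - c. The bound [form3] for that column gives
    the claim. *)
Lemma laurent_section_bounds a mu (f : pol) c i l :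
    laurent_section tri_fan a mu f -> lowest_term f c i l -> l != 0 ->
  [/\ 0 <= form2 a c i, 0 <= form3 a c i & 0 <= form4 a mu c i].
Proof.
move=> fs lt l0; have [z1 z2 e] := lowest_termP lt.
have nz : (phi f)`_c`_i != 0 by rewrite e.
have [//|ge2 ge3] := column_bounds fs _ nz; first by move=> j /z1 ->; rewrite coef0.
split=> //; pose G := (phi f)`_c.
have G0 : G != 0 by apply: contraNneq nz => G0; rewrite -/G G0 coef0.
have [|y1 [y2 [le_y y1G y2G]]] := @width_vanishing _ G (mult_e f - c) G0.
  by move=> j lt_j; apply: coef_mult_e; lia.
have le_i : (i <= y1)%N.
  by rewrite leqNgt; apply: contra y1G => /z2 ->.
have [|_] := column_bounds (c := c) fs _ y2G; first by move=> j /z1 ->; rewrite coef0.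
have [_ _ le_mu] := fs.
have : i%:Z + mu - c%:Z <= y2%:Z by lia.
by rewrite /form3 /form4; nia.
Qed.

End Bounds.

(** * Existence of the section F *)

Section ColumnArgument.

Variable k : closedFieldType.
Hypothesis char0 : [pchar k] =i pred0.
Local Notation pol := {mpoly k[2]}.

Lemma natr_injective : injective (fun n : nat => n%:R : k).
Proof.
move=> m n /= e; wlog le_mn : m n e / (m <= n)%N.
  by move=> IH; have [/IH->|/ltnW/IH->] := leqP m n.
have /eqP : (n - m)%:R = 0 :> k by rewrite natrB // e subrr.
by rewrite (pcharf0P k).1 // subn_eq0 => le_nm; apply/eqP; rewrite eqn_leq le_mn.
Qed.

(* The polynomial [sum_j Q_j(x) y^j] has total degree [n] and leading form
   [x^n].  A column with at least [n] points forces the factor [x - x0], and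
   the quotient has the same shape in degree [n - 1]. *)
Lemma column_nonvanishing (n : nat) (cols : seq nat) (Ys : nat -> seq nat)
    (Q : nat -> {poly k}) :
    uniq cols -> size cols = n.+1 -> (forall x, uniq (Ys x)) ->
    (forall x, x \in cols -> (0 < size (Ys x))%N) ->
    (forall K, (count (fun x => size (Ys x) <= K)%N cols <= K.+1)%N) ->
    Q 0 \is monic -> size (Q 0) = n.+1 ->
    (forall j, (0 < j)%N -> (size (Q j) <= n - j)%N) ->
    (forall x y, x \in cols -> y \in Ys x ->
       \sum_(j < n.+1) (Q j).[x%:R] * y%:R ^+ j = 0) ->
  False.
Proof.
move=> + + uY; elim: n cols Q => [|n IH] cols Q ucols scols posY cntY monQ sQ0 sQ van.
  case: cols ucols scols posY cntY van => [|x [|]] // _ _ posY _ van.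
  have /posY : x \in [:: x] by rewrite inE.
  case eY: (Ys x) => [|y s] // _.
  have := van x y; rewrite inE eqxx eY inE eqxx => /(_ isT isT) /eqP.
  have Q01 : Q 0 = 1 by have /eqP/size_poly1P[c _ e] := sQ0; move: monQ; rewrite e monicE lead_coefC => /eqP ->.
  by rewrite big_ord1 /= Q01 expr0 mulr1 hornerC oner_eq0.
(* Of the [n.+2] columns at most [n.+1] have [n] points or fewer. *)
have [x x_cols lt_n] : exists2 x, x \in cols & (n < size (Ys x))%N.
  apply: contrapT => no; have := cntY n; rewrite leqNgt => /negP; apply.
  rewrite (_ : count _ _ = n.+2) //; apply/eqP; rewrite -scols -all_count.
  apply/allP => x xc; rewrite leqNgt; apply/negP => lt_x; apply: no; by exists x.
(* The degree condition forces [Q n.+1 = 0], so on this column the polynomial has degree at most [n]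
   in y but more than [n] roots, which stay distinct in k in characteristic zero. *)
have root_x j : (j <= n)%N -> (Q j).[x%:R] = 0.
  move=> le_j; pose R := \poly_(j < n.+1) (Q j).[x%:R].
  suff R0 : R = 0 by have := congr1 (fun P : {poly k} => P`_j) R0; rewrite coef_poly ltnS le_j coef0.
  apply: (@roots_geq_poly_eq0 _ R [seq y%:R | y <- Ys x]).
  - apply/allP => _ /mapP[y yY ->]; rewrite rootE horner_poly.
    have := van x y x_cols yY; rewrite big_ord_recr /=.
    have -> : Q n.+1 = 0 by apply/eqP; rewrite -size_poly_eq0 -leqn0; have := sQ n.+1; rewrite subnn => ->.
    by rewrite horner0 mul0r addr0 => ->.
  - by rewrite map_inj_uniq //; exact: natr_injective.
  - by rewrite size_map; apply: leq_trans (size_poly _ _) _.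
pose Q' j := Q j %/ ('X - x%:R%:P).
have def_Q j : (j <= n)%N -> Q j = Q' j * ('X - x%:R%:P).
  by move=> le_j; rewrite /Q' divpK // dvdp_XsubCl; apply/eqP/root_x.
have sQ' j : size (Q' j) = (size (Q j)).-1 by rewrite size_divp ?polyXsubC_eq0 // size_XsubC subn1.
apply: (IH (rem x cols) Q').
- exact: rem_uniq.
- by rewrite size_rem // scols.
- by move=> x' /mem_rem /posY.
- move=> K; apply: leq_trans (cntY K).
  by have /permP -> := perm_to_rem x_cols; apply: leq_addl.
- by have := monQ; rewrite (def_Q 0%N) // monicMr // monicXsubC.
- by rewrite sQ' sQ0.
- by move=> j j0; rewrite sQ'; have := sQ j j0; lia.
move=> x' y; rewrite mem_rem_uniq // !inE => /andP[nx x'_cols] yY.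
have := van x' y x'_cols yY; rewrite big_ord_recr /=.
have -> : Q n.+1 = 0 by apply/eqP; rewrite -size_poly_eq0 -leqn0; have := sQ n.+1; rewrite subnn => ->.
rewrite horner0 mul0r addr0.
under eq_bigr => j _ do rewrite def_Q ?hornerM ?hornerXsubC -1?ltnS // mulrAC.
rewrite -mulr_suml => /eqP; rewrite mulf_eq0 subr_eq0 (inj_eq natr_injective).
by rewrite (negPf nx) orbF => /eqP.
Qed.

(** The Fredholm alternative: a row outside the row space of [A] pairs nontrivially with some vector
    of the kernel, here a column of [cokermx]. *)
Lemma linear_alternative (I J : finType) (A : I -> J -> k) (b : J -> k) :
  (exists w : I -> k, forall j, b j = \sum_i w i * A i j) \/
  (exists c : J -> k, (forall i, \sum_j A i j * c j = 0) /\ \sum_j b j * c j != 0).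
Proof.
pose MA := \matrix_(i < #|I|, j < #|J|) A (enum_val i) (enum_val j).
pose Mb := \row_(j < #|J|) b (enum_val j).
have [/submxP[w def_b]|] := boolP (Mb <= MA)%MS; [left|move=> nsub; right; move: nsub].
  exists (fun i => w ord0 (enum_rank i)) => j.
  have := congr1 (fun M : 'rV[k]_ _ => M ord0 (enum_rank j)) def_b.
  rewrite !mxE enum_rankK => ->; rewrite [RHS](reindex _ (onW_bij _ (@enum_val_bij I))) /=.
  by apply: eq_bigr => i _; rewrite mxE enum_rankK enum_valK.
rewrite submxE => /eqP nz.
have [j0 nz0] : exists j0, (Mb *m cokermx MA) ord0 j0 != 0.
  apply: contrapT => no; apply: nz; apply/rowP => j; rewrite [RHS]mxE.
  by apply/eqP; apply: contrapT => /negP ?; apply: no; exists j.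
exists (fun j => cokermx MA (enum_rank j) j0); split.
  move=> i; have := congr1 (fun M : 'M[k]_ _ => M (enum_rank i) j0) (mulmx_coker MA).
  rewrite !mxE => e; rewrite -[RHS]e [LHS](reindex _ (onW_bij _ (@enum_val_bij J))) /=.
  by apply: eq_bigr => j _; rewrite !mxE enum_rankK enum_valK.
apply: contraNneq nz0 => e; apply/eqP; rewrite !mxE -[RHS]e.
rewrite [in RHS](reindex _ (onW_bij _ (@enum_val_bij J))) /=.
by apply: eq_bigr => j _; rewrite !mxE enum_valK.
Qed.

End ColumnArgument.

(** * Lattice points of the triangle with vertices (0, 0), (q r, 0) and (q (p + r), p (p + r)) *)

Section TriangleColumns.

Variables (p q r t : nat).
Hypotheses (p_gt0 : (0 < p)%N) (q_gt0 : (0 < q)%N) (r_gt0 : (0 < r)%N).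
Hypotheses (qt_eq : (q * t = p + r)%N) (area_le : (q * (p + r) <= p * r)%N).

Let m := (q * (p + r))%N.

(** Truncated subtraction gives 0 over the base; beyond it this is the exact height of the right
    edge, an integer because [t] is one. *)
Definition column_bottom (x : nat) : nat := (t * (x - q * r))%N.
Definition column (x : nat) : seq nat :=
  iota (column_bottom x) ((p * x %/ q).+1 - column_bottom x).

Lemma mem_column x y : y \in column x -> (column_bottom x <= y)%N /\ (q * y <= p * x)%N.
Proof.
clear p_gt0 r_gt0 qt_eq area_le.
rewrite mem_iota => /andP[le_y lt_y]; split=> //.
have : (y <= p * x %/ q)%N by lia.
by rewrite leq_divRL // mulnC.
Qed.

Lemma bottom_mul x : (q * column_bottom x = (p + r) * (x - q * r))%N.
Proof. by rewrite /column_bottom mulnA qt_eq. Qed.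

Lemma column_gt0 x : (x <= m)%N -> (0 < size (column x))%N.
Proof.
move=> le_x; rewrite size_iota subn_gt0 ltnS leq_divRL // mulnC bottom_mul.
have [le_qr|lt_qr] := leqP x (q * r); first by rewrite (eqP le_qr) muln0.
by move: le_x lt_qr; rewrite /m; nia.
Qed.

(** The column has height p x / q over the base and r (m - x) / q beyond it. As its lower end is a
    lattice point, at most [K] points means height below [K]. *)
Lemma column_small x K : (x <= m)%N -> (size (column x) <= K)%N ->
  (p * x < q * K)%N || (r * (m - x) < q * K)%N.
Proof.
move=> le_x; rewrite size_iota => sK.
have : (p * x %/ q < K + column_bottom x)%N by lia.
rewrite ltn_divLR // mulnDl -[(column_bottom x * q)%N]mulnC bottom_mul => lt_px.
have [le_qr|lt_qr] := leqP x (q * r).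
  by move: lt_px; rewrite (eqP le_qr) muln0 addn0 [(K * q)%N]mulnC => ->.
by apply/orP; right; move: le_x lt_qr lt_px; rewrite /m; nia.
Qed.

Lemma count_interval (P : pred nat) n a b :
  (forall x, (x < n)%N -> P x -> (a <= x < a + b)%N) -> (count P (iota 0 n) <= b)%N.
Proof.
move=> Pab; rewrite -size_filter -(size_iota a b); apply: uniq_leq_size.
  by rewrite filter_uniq // iota_uniq.
move=> x; rewrite mem_filter !mem_iota add0n => /and3P[Px _ lt_x]; exact: Pab.
Qed.

(** Short columns lie near the left vertex or near the apex, at most [N1], the ceiling of q K / p,
    and [N2], the ceiling of q K / r, of them. Each ceiling adds less than 1 and [area_le] says q /
    p + q / r <= 1, so the integer [N1 + N2] is below K + 2. *)
Lemma count_small_columns K :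
  (count (fun x => size (column x) <= K)%N (iota 0 m.+1) <= K.+1)%N.
Proof.
pose N1 := ((q * K + p.-1) %/ p)%N; pose N2 := ((q * K + r.-1) %/ r)%N.
have ceil d : (0 < d)%N -> (q * K <= (q * K + d.-1) %/ d * d < q * K + d)%N.
  move=> d0; have := divn_eq (q * K + d.-1) d; have := ltn_pmod (q * K + d.-1) d0.
  move: (_ %/ _)%N (_ %% _)%N => a b; lia.
have /andP[N1l N1u] := ceil p p_gt0; have /andP[N2l N2u] := ceil r r_gt0.
rewrite -/N1 -/N2 in N1l N1u N2l N2u.
have le_N : (N1 + N2 <= K.+1)%N.
  have lt1 : (N1 * p * r < (q * K + p) * r)%N by rewrite ltn_pmul2r.
  have lt2 : (N2 * r * p < (q * K + r) * p)%N by rewrite ltn_pmul2r.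
  have leK : (q * (p + r) * K <= p * r * K)%N by rewrite leq_mul2r area_le orbT.
  have : ((N1 + N2) * (p * r) < K.+2 * (p * r))%N by lia.
  by rewrite ltn_pmul2r // muln_gt0 p_gt0.
apply: leq_trans le_N.
pose P1 := fun x => (p * x < q * K)%N; pose P2 := fun x => (r * (m - x) < q * K)%N.
have le1 : (count P1 (iota 0 m.+1) <= N1)%N.
  apply: (@count_interval _ _ 0) => x _ Px; rewrite add0n /=.
  by move: Px N1l; rewrite /P1; nia.
have le2 : (count P2 (iota 0 m.+1) <= N2)%N.
  apply: (@count_interval _ _ (m.+1 - N2)) => x; rewrite ltnS => le_x Px.
  have : (m - x < N2)%N by move: Px N2l; rewrite /P2; nia.
  lia.
apply: leq_trans (leq_add le1 le2).
apply: (@leq_trans (count (predU P1 P2) (iota 0 m.+1))).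
  rewrite -!size_filter; apply: uniq_leq_size; first by rewrite filter_uniq // iota_uniq.
  move=> x; rewrite !mem_filter mem_iota add0n ltnS => /andP[sx le_x].
  by rewrite /= column_small //= ltnS.
by rewrite -count_predUI leq_addr.
Qed.

End TriangleColumns.

(** * A section of multiplicity q (p + r) at e that does not vanish on C *)

Section ApexCurve.

Variable k : closedFieldType.
Hypothesis char0 : [pchar k] =i pred0.
Local Notation pol := {mpoly k[2]}.

(** The Taylor coefficients of a monomial at e are binomials in its exponents. As these are
    polynomials of degree [i] in characteristic zero, vanishing at e reduces to vanishing
    moments. *)
Lemma bin_poly (i : nat) : exists2 B : {poly k}, (size B <= i.+1)%N &
  forall x : nat, B.[x%:R] = 'C(x, i)%:R.
Proof.
have fact0 : i`!%:R != 0 :> k by rewrite (pcharf0P k).1 // -lt0n fact_gt0.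
exists (i`!%:R^-1 *: \prod_(l < i) ('X - l%:R%:P)).
  apply: leq_trans (size_scale_leq _ _) _.
  by rewrite -big_enum /= size_prod_XsubC size_enum_ord.
move=> x; rewrite hornerZ horner_prod.
have -> : \prod_(l < i) ('X - l%:R%:P).[x%:R] = (x ^_ i)%:R :> k.
  elim: (i) => [|n IH]; first by rewrite big_ord0 ffactn0.
  rewrite big_ord_recr IH /= hornerXsubC ffactnSr natrM.
  have [le_n|lt_n] := leqP n x; first by rewrite natrB.
  by rewrite ffact_small // !mul0r.
by rewrite -bin_ffact natrM mulrC mulfK.
Qed.

Lemma phi_monomial x y i j :
  ((phi ('X_[mon2 x y] : pol))`_j \Po ('X + 1))`_i = 'C(x, i)%:R * 'C(y, j)%:R.
Proof.
rewrite /phi /= psiX mon2_0 mon2_1 rmorphM /= comp_polyC comp_Xn_poly coefCM.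
rewrite coef_XD1_exp rmorphM /= comp_Xn_poly rmorph_nat mulr_natr coefMn coef_XD1_exp.
by rewrite mulr_natr.
Qed.

(** The coefficients of [F] define a functional on polynomials through their values at the lattice
    points of the triangle. It kills all degrees below m, which is the vanishing at e, but not x^m,
    which keeps F(x, 1) nonzero. *)
Lemma exists_apex_curve (p q r t : nat) :
    (0 < p)%N -> (0 < q)%N -> (0 < r)%N ->
    (q * t = p + r)%N -> (q * (p + r) <= p * r)%N ->
  exists F : pol, [/\ F != 0,
    forall mo, mo \in msupp F ->
      (t * (mo ord0 - q * r) <= mo ord_max)%N /\ (q * mo ord_max <= p * mo ord0)%N,
    (q * (p + r) <= mult_e F)%N
    & exists2 l, l != 0 & lowest_term F 0 0 l].
Proof.
move=> p0 q0 r0 qt area; set m := (q * (p + r))%N.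
(* In the triangle q y <= p x and x <= m, so p m bounds all heights. *)
pose N := (p * m).+1.
pose S (xy : 'I_m.+1 * 'I_N) := (val xy.2 \in column p q r t xy.1).
pose A (ij : 'I_m * 'I_m) (xy : 'I_m.+1 * 'I_N) : k :=
  if S xy && (ij.1 + ij.2 < m)%N then xy.1%:R ^+ ij.1 * xy.2%:R ^+ ij.2 else 0.
pose b (xy : 'I_m.+1 * 'I_N) : k := if S xy then xy.1%:R ^+ m else 0.
have m0 : (0 < m)%N by rewrite muln_gt0 q0 addn_gt0 p0.
case: (linear_alternative A b) => [[w def_b]|[c [Ac bc]]].
  exfalso.
  (* [W] extends [w] by zero, and [Q j] below is the coefficient of y^j in x^m minus the terms W i j
     x^i y^j. This polynomial would vanish on every column. *)
  pose W i j : k := if (i + j < m)%N then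
     (if insub i is Some i' then if insub j is Some j' then w (i', j') else 0 else 0) else 0.
  have W0 i j : (m <= i + j)%N -> W i j = 0 by rewrite /W ltnNge => ->.
  have WE (i j : 'I_m) : W i j = if (i + j < m)%N then w (i, j) else 0.
    by rewrite /W !valK.
  pose T (j : nat) := \poly_(i < m) W i j.
  have sT j : (size (T j) <= m - j)%N.
    by apply/leq_sizeP => i le_i; rewrite coef_poly W0 ?if_same //; lia.
  pose Q (j : nat) := (if j == 0%N then 'X^m else 0) - T j.
  have sT0 : (size (- T 0%N)%R < size ('X^m : {poly k}))%N.
    by rewrite size_polyXn ltnS size_polyN; apply: leq_trans (sT _) _; rewrite subn0.
  apply: (@column_nonvanishing k char0 m (iota 0 m.+1) (column p q r t) Q).
  - exact: iota_uniq.
  - by rewrite size_iota.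
  - by move=> x; apply: iota_uniq.
  - by move=> x; rewrite mem_iota add0n ltnS => le_x; apply: column_gt0.
  - exact: count_small_columns.
  - by rewrite monicE /Q eqxx lead_coefDl // lead_coefXn.
  - by rewrite /Q eqxx size_polyDl // size_polyXn.
  - by move=> [|j] // _; rewrite /Q /= sub0r size_polyN.
  move=> x y; rewrite mem_iota add0n => /andP[_ lt_x] y_col.
  have [|_ le_y] := mem_column _ y_col; first exact: q0.
  have lt_y : (y < N)%N by rewrite /N ltnS; nia.
  have := def_b (Ordinal lt_x, Ordinal lt_y).
  rewrite /b /A /S /= y_col /= => e.
  have -> : \sum_(j < m.+1) (Q j).[x%:R] * y%:R ^+ j
      = x%:R ^+ m - \sum_(j < m.+1) (T j).[x%:R] * y%:R ^+ j.
    rewrite big_ord_recl [in RHS]big_ord_recl /Q /= !expr0 !mulr1 hornerD hornerN hornerXn.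
    rewrite opprD addrA -sumrN; congr (_ + _); apply: eq_bigr => j _.
    by rewrite sub0r hornerN mulNr.
  rewrite big_ord_recr /= [T m](_ : _ = 0) ?horner0 ?mul0r ?addr0; last first.
    by apply/eqP; rewrite -size_poly_eq0 -leqn0; have := sT m; rewrite subnn.
  apply/eqP; rewrite subr_eq0 e; apply/eqP.
  under [RHS]eq_bigr => j _ do rewrite horner_poly mulr_suml.
  rewrite exchange_big pair_big /=; apply: eq_bigr => -[i j] _ /=.
  by rewrite WE; case: ifP => _; rewrite ?mulr0 ?mul0r // mulrA.
pose d (xy : 'I_m.+1 * 'I_N) : k := if S xy then c xy else 0.
pose F : pol := \sum_xy d xy *: 'X_[mon2 xy.1 xy.2].
have moment i j : (i + j < m)%N -> \sum_xy d xy * (xy.1%:R ^+ i * xy.2%:R ^+ j) = 0.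
  move=> lt_ij; have lt_i : (i < m)%N by lia.
  have lt_j : (j < m)%N by lia.
  rewrite -[RHS](Ac (Ordinal lt_i, Ordinal lt_j)); apply: eq_bigr => xy _.
  by rewrite /A /d /= lt_ij andbT; case: ifP => _; rewrite ?mul0r // mulrC.
have moment_m : \sum_xy d xy * xy.1%:R ^+ m != 0.
  apply: contraNneq bc => e; apply/eqP; rewrite -[RHS]e; apply: eq_bigr => xy _.
  by rewrite /b /d; case: ifP => _; rewrite ?mul0r // mulrC.
have vanF i j : (i + j < m)%N -> ((phi F)`_j \Po ('X + 1))`_i = 0.
  move=> lt_ij; rewrite -coef_shift_e.
  have -> : shift_e F = \sum_xy d xy *: shift_e ('X_[mon2 xy.1 xy.2] : pol).
    rewrite /F (raddf_sum (@shift_e k)) /=; apply: eq_bigr => xy _.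
    by rewrite /shift_e comp_mpolyZ.
  rewrite raddf_sum /=.
  have [B sB BE] := bin_poly i; have [B' sB' B'E] := bin_poly j.
  transitivity (\sum_xy d xy * (B.[xy.1%:R] * B'.[xy.2%:R])).
    apply: eq_bigr => xy _.
    by rewrite mcoeffZ coef_shift_e phi_monomial BE B'E.
  transitivity (\sum_xy \sum_(i' < size B) \sum_(j' < size B')
      B`_i' * B'`_j' * (d xy * (xy.1%:R ^+ i' * xy.2%:R ^+ j'))).
    apply: eq_bigr => xy _; rewrite !horner_coef mulr_suml mulr_sumr.
    apply: eq_bigr => i' _; rewrite mulr_sumr mulr_sumr.
    by apply: eq_bigr => j' _; rewrite [RHS]mulrCA; congr (_ * _); rewrite mulrACA.
  rewrite exchange_big big1 // => i' _; rewrite exchange_big big1 // => j' _.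
  rewrite -mulr_sumr moment ?mulr0 //.
  by have := ltn_ord i'; have := ltn_ord j'; lia.
pose v := (phi F)`_0.
have def_v : v = \sum_xy d xy *: 'X^(xy.1).
  rewrite /v /F (raddf_sum (@phi k)) /= coef_sum; apply: eq_bigr => xy _.
  rewrite /phi /= psiZ psiX mon2_0 mon2_1 !rmorphM /= !comp_polyC comp_Xn_poly !coefCM.
  by rewrite coef_XD1_exp bin0 mulr1 mul_polyC.
(* The moment of x^m depends only on the column sums of [d], which are the coefficients of [v], that
   is, of F(x, 1). *)
have v0 : v != 0.
  apply: contraNneq moment_m => e; apply/eqP.
  transitivity (\sum_(x < m.+1) v`_x * x%:R ^+ m); last first.
    by rewrite e big1 // => x _; rewrite coef0 mul0r.
  rewrite def_v; under [RHS]eq_bigr => x _ do rewrite coef_sum mulr_suml.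
  rewrite exchange_big; apply: eq_bigr => xy _ /=.
  rewrite (bigD1 xy.1) //= coefZ coefXn eqxx mulr1 big1 ?addr0 // => x /negPf nx.
  by rewrite coefZ coefXn (_ : (_ == _) = (x == xy.1)) // nx mulr0 mul0r.
have F0 : F != 0.
  by apply: contraNneq v0 => e; rewrite /v e /phi /= rmorph0 comp_poly0 coef0.
exists F; split=> //.
- move=> mo; rewrite mcoeff_msupp => Fmo.
  have [xy dxy ->] : exists2 xy, d xy != 0 & mo = mon2 xy.1 xy.2.
    apply: contrapT => no; case/eqP: Fmo; rewrite /F raddf_sum big1 // => xy _ /=.
    rewrite mcoeffZ mcoeffX; have [->|dxy] := eqVneq (d xy) 0; first by rewrite mul0r.
    by case: eqP => [e|]; rewrite ?mulr0 //; case: no; exists xy.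
  rewrite mon2_0 mon2_1; move: dxy; rewrite /d /S; case: ifP; rewrite ?eqxx //.
  move=> Sxy _; exact: (mem_column q0 Sxy).
- by apply: le_mult_e.
exists v.[0].
  (* (x - 1)^m divides [v], whose degree is at most m; the exponents therefore run from 0 to m and
     the constant term is nonzero. *)
  have [|y1 [y2 [le_y y1v y2v]]] := @width_vanishing _ v m v0.
    by move=> j lt_j; apply: vanF; rewrite addn0.
  have : (y2 <= m)%N.
    rewrite leqNgt; apply: contra y2v => lt_y2; rewrite def_v coef_sum big1 // => xy _.
    rewrite coefZ coefXn; case: eqP => [e|]; rewrite ?mulr0 //.
    by move: (ltn_ord xy.1); rewrite -e ltnNge lt_y2.
  by move=> le_m; move: y1v; rewrite horner_coef0 (_ : y1 = 0%N) //; lia.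
have [R eR] : exists R, phi F = v%:P + 'X * R.
  rewrite /v; elim/poly_ind: (phi F) => [|P a _].
    by exists 0; rewrite coef0 mulr0 addr0.
  by exists P; rewrite coefD coefMX coefC !eqxx add0r addrC mulrC.
by exists v, R; rewrite !expr0 !mul1r.
Qed.

End ApexCurve.

(** * Dickson's lemma *)

Section Dickson.

(** The finite basis property of well-quasi-orders, with [R y x] in the role of [y <= x]. *)
Definition finite_basis (T : eqType) (R : T -> T -> Prop) : Prop :=
  forall P : T -> Prop, exists s : seq T,
    (forall x, x \in s -> P x) /\
    (forall x, P x -> exists2 y, y \in s & R y x).

Lemma finite_basis_unit : finite_basis (fun _ _ : unit => True).
Proof.
move=> P; have [Pt|nPt] := pselect (P tt).
  by exists [:: tt]; split=> [[]|[]] // _; exists tt.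
by exists [::]; split=> // -[] /nPt.
Qed.

Lemma finite_basis_slices (T U : eqType) (P : U -> Prop) (F : nat -> T -> U)
    (R : U -> U -> Prop) (n : nat) :
    (forall j, (j < n)%N -> exists s : seq U, (forall x, x \in s -> P x) /\
      (forall z, P (F j z) -> exists2 y, y \in s & R y (F j z))) ->
  exists s : seq U, (forall x, x \in s -> P x) /\
    (forall j z, (j < n)%N -> P (F j z) -> exists2 y, y \in s & R y (F j z)).
Proof.
elim: n => [|n IH] slice; first by exists [::].
have [|s [sP sR]] := IH; first by move=> j lt_j; apply: slice; apply: ltnW.
have [s' [sP' sR']] := slice n (ltnSn n).
exists (s ++ s'); split=> [x|j z].
  by rewrite mem_cat => /orP[/sP|/sP'].
rewrite ltnS leq_eqVlt => /orP[/eqP->|lt_j] Pz.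
  by have [y ys Ry] := sR' z Pz; exists y; rewrite // mem_cat ys orbT.
by have [y ys Ry] := sR j z lt_j Pz; exists y; rewrite // mem_cat ys.
Qed.

(** A finite basis of the projection to [T] is lifted to [s2] inside [P]. The lifts serve all pairs
    whose second entry is at least [M], the maximum over [s2]; below [M] only finitely many slices
    remain. *)
Lemma finite_basis_prod_nat (T : eqType) (R : T -> T -> Prop) : finite_basis R ->
  finite_basis (fun y x : T * nat => R y.1 x.1 /\ (y.2 <= x.2)%N).
Proof.
move=> fbR P; have [s1 [s1P s1R]] := fbR (fun a => exists b, P (a, b)).
have [s2 [s2P s2s]] : exists s2 : seq (T * nat), (forall x, x \in s2 -> P x) /\
    (forall a, a \in s1 -> exists2 x, x \in s2 & x.1 = a).
  elim: s1 s1P {s1R} => [|a s1 IH] s1P; first by exists [::].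
  have [|s2 [s2P s2s]] := IH; first by move=> x xs; apply: s1P; rewrite inE xs orbT.
  have [b Pab] := s1P a (mem_head _ _).
  exists ((a, b) :: s2); split=> [x|a'].
    by rewrite inE => /orP[/eqP->|/s2P].
  rewrite inE => /orP[/eqP->|/s2s[x xs <-]]; first by exists (a, b); rewrite ?mem_head.
  by exists x; rewrite // inE xs orbT.
pose M := (\max_(x <- s2) x.2)%N.
have [|s3 [s3P s3R]] := @finite_basis_slices T (T * nat)%type P (fun b a => (a, b))
    (fun y x => R y.1 x.1 /\ (y.2 <= x.2)%N) M.
  move=> b _; have [s [sP sR]] := fbR (fun a => P (a, b)).
  exists [seq (a, b) | a <- s]; split=> [_ /mapP[a /sP ? ->] //|a /sR[a' a's Ra]].
  by exists (a', b) => //; apply/mapP; exists a'.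
exists (s2 ++ s3); split=> [x|[a b] Pab].
  by rewrite mem_cat => /orP[/s2P|/s3P].
have [le_M|lt_M] := leqP M b; last first.
  by have [y ys Ry] := s3R b a lt_M Pab; exists y; rewrite // mem_cat ys orbT.
have [|a' /s2s[x xs <-] Rx] := s1R a; first by exists b.
exists x; first by rewrite mem_cat xs.
by split=> //=; apply: leq_trans le_M; rewrite /M (leq_bigmax_seq x xs).
Qed.

(** Inside each of the [N] residue classes, comparing quotients by [<=] is the same as adding
    multiples of [N]. *)
Lemma finite_basis_prod_cong (T : eqType) (R : T -> T -> Prop) (N : nat) : (0 < N)%N ->
  finite_basis R ->
  finite_basis (fun y x : T * nat => R y.1 x.1 /\ exists n, x.2 = (y.2 + N * n)%N).
Proof.
move=> N0 /finite_basis_prod_nat fbR P.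
have [|s [sP sR]] := @finite_basis_slices (T * nat)%type (T * nat)%type P
    (fun j z => (z.1, j + N * z.2)%N)
    (fun y x => R y.1 x.1 /\ exists n, x.2 = (y.2 + N * n)%N) N.
  move=> j _; have [s [sP sR]] := fbR (fun z => P (z.1, j + N * z.2)%N).
  exists [seq (z.1, j + N * z.2)%N | z <- s]; split=> [_ /mapP[z /sP ? ->] //|z /sR[y ys [Ry le_y]]].
  exists (y.1, j + N * y.2)%N; first by apply/mapP; exists y.
  by split=> //=; exists (z.2 - y.2)%N; rewrite -addnA -mulnDr subnKC.
exists s; split=> // -[a b] Pab.
have eb : (b %% N + N * (b %/ N))%N = b by rewrite mulnC addnC -divn_eq.
have := sR (b %% N)%N (a, b %/ N)%N; rewrite /= eb ltn_pmod //; exact.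
Qed.

Lemma dickson4 (N1 N2 N3 N4 : nat) (P : nat -> nat -> nat -> nat -> Prop) :
    (0 < N1)%N -> (0 < N2)%N -> (0 < N3)%N -> (0 < N4)%N ->
  exists s : seq (nat * nat * nat * nat),
    (forall y, y \in s -> P y.1.1.1 y.1.1.2 y.1.2 y.2) /\
    (forall x1 x2 x3 x4, P x1 x2 x3 x4 -> exists2 y, y \in s &
      exists n1 n2 n3 n4,
        [/\ x1 = y.1.1.1 + N1 * n1, x2 = y.1.1.2 + N2 * n2,
            x3 = y.1.2 + N3 * n3 & x4 = y.2 + N4 * n4]%N).
Proof.
move=> N1_0 N2_0 N3_0 N4_0.
have fb := finite_basis_prod_cong N4_0 (finite_basis_prod_cong N3_0
  (finite_basis_prod_cong N2_0 (finite_basis_prod_cong N1_0 finite_basis_unit))).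
have [s [sP sR]] := fb (fun z => P z.1.1.1.2 z.1.1.2 z.1.2 z.2).
exists [seq (z.1.1.1.2, z.1.1.2, z.1.2, z.2) | z <- s]; split.
  by move=> _ /mapP[z /sP ? ->].
move=> x1 x2 x3 x4 Px; have := sR (tt, x1, x2, x3, x4) Px.
move=> [z zs [[[[_ [n1 e1]] [n2 e2]] [n3 e3]] [n4 e4]]].
exists (z.1.1.1.2, z.1.1.2, z.1.2, z.2); first by apply/mapP; exists z.
by exists n1, n2, n3, n4.
Qed.

End Dickson.

(** * Sections with a chosen lowest term *)

Section SectionAlgebra.

Variables (k : closedFieldType) (u : 'I_3 -> int * int).
Local Notation pol := {mpoly k[2]}.

Lemma ord_boundaryC v (c : k) : c != 0 -> ord_boundary v (c%:MP : pol) = 0.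
Proof. exact: (min_weightC (pairingD v)). Qed.

Lemma ord_boundaryX v m : ord_boundary v ('X_[m] : pol) = pairing v m.
Proof. exact: min_weightX. Qed.

Lemma ord_boundary_le v (f : pol) m : m \in msupp f -> ord_boundary v f <= pairing v m.
Proof. exact: min_weight_le. Qed.

Lemma laurent_sectionM a mu f a' mu' (g : pol) :
  laurent_section u a mu f -> laurent_section u a' mu' g ->
  laurent_section u (fun i => a i + a' i) (mu + mu') (f * g).
Proof.
move=> [f0 fa fm] [g0 ga gm]; split=> [|i|]; first by rewrite mulf_neq0.
  by rewrite ord_boundaryM // addrACA addr_ge0.
by rewrite mult_eM // PoszD lerD.
Qed.

Lemma laurent_section1 : laurent_section u (fun=> 0) 0 (1 : pol).
Proof.
split=> [|i|//]; first exact: oner_neq0.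
by rewrite -mpolyC1 ord_boundaryC ?oner_neq0.
Qed.

Lemma laurent_sectionX m : laurent_section u (fun i => - pairing (u i) m) 0 ('X_[m] : pol).
Proof.
split=> [|i|//]; first by rewrite -msize_poly_eq0 msizeX.
by rewrite ord_boundaryX subrr.
Qed.

Lemma laurent_sectionZ a mu (c : k) (f : pol) : c != 0 ->
  laurent_section u a mu f -> laurent_section u a mu (c *: f).
Proof.
move=> c0 [f0 fa fm]; have cP0 : c%:MP != 0 :> pol by rewrite mpolyC_eq0.
rewrite -mul_mpolyC; split=> [|i|]; first by rewrite mulf_neq0.
  by rewrite ord_boundaryM // ord_boundaryC // add0r.
by rewrite mult_eM // mult_eC.
Qed.

Lemma laurent_sectionB a mu (f g : pol) : f - g != 0 ->
    laurent_section u a mu f -> laurent_section u a mu g ->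
  laurent_section u a mu (f - g).
Proof.
move=> fg0 [f0 fa fm] [g0 ga gm]; split=> // [i|].
  rewrite -lerBlDr; apply: (@le_min_weight _ (pairing (u i))) => // m.
  move/msuppB_le; rewrite mem_cat lerBlDr => /orP[mf|mg].
    by apply: le_trans (fa i) _; rewrite lerD2r; apply: ord_boundary_le.
  by apply: le_trans (ga i) _; rewrite lerD2r; apply: ord_boundary_le.
(* For negative [mu] the condition at e is void. *)
case: mu fm gm {fa ga} => [n|n] // fm gm.
rewrite lez_nat; apply: le_mult_e => // i c lt_ic.
rewrite raddfB coefB comp_polyB coefB.
by rewrite !coef_mult_e ?subrr //; apply: leq_trans lt_ic _.
Qed.

End SectionAlgebra.

(** * The semigroup of classes with lowest terms *)

Section Generators.

Variables (k : closedFieldType) (p q t : int).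
Local Notation pol := {mpoly k[2]}.
Let u := tri_fan p q t.

(** An element of the semigroup bundled with a section that realizes it, so that products of
    elements carry their sections along. *)
Record lead_section := LeadSection {
  ls_bd : 'I_3 -> int;
  ls_mult : int;
  ls_pol : pol;
  ls_c : nat;
  ls_i : nat;
  ls_coef : k;
  ls_sectionP : laurent_section u ls_bd ls_mult ls_pol;
  ls_lowestP : lowest_term ls_pol ls_c ls_i ls_coef;
  ls_coef_neq0 : ls_coef != 0 }.

Definition ls1 : lead_section :=
  LeadSection (laurent_section1 k u) (lowest_term1 k) (oner_neq0 k).

Definition lsM (x y : lead_section) : lead_section :=
  LeadSection (laurent_sectionM (ls_sectionP x) (ls_sectionP y))
    (lowest_termM (ls_lowestP x) (ls_lowestP y))
    (mulf_neq0 (ls_coef_neq0 x) (ls_coef_neq0 y)).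

Fixpoint lsX (x : lead_section) (n : nat) : lead_section :=
  if n is n'.+1 then lsM x (lsX x n') else ls1.

Definition ls_prod (n : nat) (G : 'I_n -> lead_section) (e : 'I_n -> nat) : lead_section :=
  \big[lsM/ls1]_i lsX (G i) (e i).

Definition ls_form2 x := form2 p q (ls_bd x) (ls_c x) (ls_i x).
Definition ls_form3 x := form3 p q t (ls_bd x) (ls_c x) (ls_i x).
Definition ls_form4 x := form4 p q t (ls_bd x) (ls_mult x) (ls_c x) (ls_i x).

Lemma ls_additiveX (h : lead_section -> int) :
    h ls1 = 0 -> (forall x y, h (lsM x y) = h x + h y) ->
  forall x n, h (lsX x n) = n%:Z * h x.
Proof.
move=> h1 hM x; elim=> [|n IH]; first by rewrite h1 mul0r.
by rewrite hM IH intS mulrDl mul1r.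
Qed.

Lemma ls_additive_prod (h : lead_section -> int) :
    h ls1 = 0 -> (forall x y, h (lsM x y) = h x + h y) ->
  forall n (G : 'I_n -> lead_section) e, h (ls_prod G e) = \sum_i (e i)%:Z * h (G i).
Proof.
move=> h1 hM n G e; rewrite /ls_prod (big_morph h hM h1).
by apply: eq_bigr => i _; apply: ls_additiveX.
Qed.

Lemma ls_pol_prod n (G : 'I_n -> lead_section) e :
  ls_pol (ls_prod G e) = \prod_i ls_pol (G i) ^+ e i.
Proof.
rewrite /ls_prod (big_morph ls_pol (fun x y => erefl) erefl); apply: eq_bigr => i _.
by elim: (e i) => [|m IH] //=; rewrite exprS IH.
Qed.

Lemma ls_form2M x y : ls_form2 (lsM x y) = ls_form2 x + ls_form2 y.
Proof. by rewrite /ls_form2 /form2 /= !PoszD; ring. Qed.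
Lemma ls_form3M x y : ls_form3 (lsM x y) = ls_form3 x + ls_form3 y.
Proof. by rewrite /ls_form3 /form3 /= !PoszD; ring. Qed.
Lemma ls_form4M x y : ls_form4 (lsM x y) = ls_form4 x + ls_form4 y.
Proof. by rewrite /ls_form4 /form4 /= !PoszD; ring. Qed.
Lemma ls_form2_1 : ls_form2 ls1 = 0.
Proof. by rewrite /ls_form2 /form2 /=; ring. Qed.
Lemma ls_form3_1 : ls_form3 ls1 = 0.
Proof. by rewrite /ls_form3 /form3 /=; ring. Qed.
Lemma ls_form4_1 : ls_form4 ls1 = 0.
Proof. by rewrite /ls_form4 /form4 /=; ring. Qed.

Definition ls_divisor x := laurent_divisor k (ls_bd x) (ls_mult x).

Lemma coeff_ls_divisor_prod n (G : 'I_n -> lead_section) e P :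
  coeff P (\sum_i ls_divisor (G i) *+ e i) = coeff P (ls_divisor (ls_prod G e)).
Proof.
rewrite raddf_sum /= [RHS](ls_additive_prod (h := fun x => coeff P (ls_divisor x))).
- by apply: eq_bigr => i _; rewrite coeffMn -mulr_natl natz.
- case: P => [[i|[]]|c]; rewrite ?coeff_laurent_boundary ?coeff_laurent_exceptional //.
  exact: coeff_laurent_curve.
move=> x y; case: P => [[i|[]]|c].
- by rewrite !coeff_laurent_boundary.
- by rewrite !coeff_laurent_exceptional /= opprD.
by rewrite !coeff_laurent_curve.
Qed.

Hypotheses (q_gt0 : 0 < q) (r_gt0 : 0 < q * t - p).

Lemma ls_bounds x : [/\ 0 <= ls_form2 x, 0 <= ls_form3 x & 0 <= ls_form4 x].
Proof.
exact: (laurent_section_bounds q_gt0 r_gt0 (ls_sectionP x) (ls_lowestP x) (ls_coef_neq0 x)).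
Qed.

(* [c] and the three forms determine the class and the lowest exponent up to a
   monomial. *)
Lemma ls_translate x y :
    ls_c x = ls_c y -> ls_form2 x = ls_form2 y -> ls_form3 x = ls_form3 y ->
    ls_form4 x = ls_form4 y ->
  exists m1 m2 : 'X_{1..2},
    [/\ forall i, ls_bd x i - pairing (u i) m1 = ls_bd y i - pairing (u i) m2,
        ls_mult x = ls_mult y
      & (m1 ord0 + ls_i x = m2 ord0 + ls_i y)%N].
Proof.
rewrite /ls_form2 /ls_form3 /ls_form4 /form2 /form3 /form4 => ec; rewrite ec => e2 e3 e4.
pose d := ls_bd x o0 - ls_bd y o0.
have [y1 [y2 ed]] : exists y1 y2 : nat, y1%:Z - y2%:Z = d.
  case: (d) => n; first by exists n, 0%N; rewrite subr0.
  by exists 0%N, n.+1; rewrite NegzE add0r.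
(* Each section is multiplied by x to the exponent of the other, which makes these exponents equal;
   the powers of y absorb the difference of the base coefficients. *)
exists (mon2 (ls_i y) y1), (mon2 (ls_i x) y2); split.
- move=> i; case: (ord3P i) => ->; rewrite /pairing /u /tri_fan /= !mon2_0 !mon2_1.
  + by rewrite /d in ed; lia.
  + by rewrite /d in ed; nia.
  rewrite /d in ed; apply: (@mulfI _ q); first by rewrite gt_eqF.
  by nia.
- have : (q * t - p) * ls_mult x = (q * t - p) * ls_mult y by nia.
  by apply: mulfI; rewrite gt_eqF.
by rewrite !mon2_0 addnC.
Qed.

End Generators.

(** * Descent *)

Section Descent.

Variables (k : closedFieldType) (p q t : int).
Hypotheses (p_gt0 : 0 < p) (q_gt0 : 0 < q) (r_gt0 : 0 < q * t - p).
Local Notation pol := {mpoly k[2]}.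
Local Notation "x %:F" := (tofrac x).
Let u := tri_fan p q t.
Local Notation gen := (lead_section k p q t).

Lemma form2_shift a c i m :
  form2 p q (fun j => a j - pairing (u j) m) c (m ord0 + i) = form2 p q a c i.
Proof. by rewrite /form2 /pairing /u /tri_fan /= PoszD; ring. Qed.

Lemma form3_shift a c i m :
  form3 p q t (fun j => a j - pairing (u j) m) c (m ord0 + i) = form3 p q t a c i.
Proof. by rewrite /form3 /pairing /u /tri_fan /= PoszD; ring. Qed.

(** The positive combination of [form2] and [form3] in which [i] cancels: on a fixed class it
    depends on [c] alone. *)
Definition descent_form (a : 'I_3 -> int) (c i : nat) : int :=
  (q * t - p) * form2 p q a c i + p * form3 p q t a c i.

Lemma descent_form_indep a c i i' : descent_form a c i = descent_form a c i'.
Proof. by rewrite /descent_form /form2 /form3; ring. Qed.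

Lemma descent_form_lt a c i c' i' : (c < c')%N ->
  descent_form a c' i' < descent_form a c i.
Proof.
move=> lt_c; rewrite -subr_gt0.
have -> : descent_form a c i - descent_form a c' i' = q * (q * t) * (c'%:Z - c%:Z).
  by rewrite /descent_form /form2 /form3; ring.
have qt_gt0 : 0 < q * t by lia.
by apply: mulr_gt0; [exact: mulr_gt0|rewrite subr_gt0 ltz_nat].
Qed.

Lemma form3_lt a c i i' : (i < i')%N -> form3 p q t a c i' < form3 p q t a c i.
Proof.
move=> lt_i; rewrite -subr_gt0.
have -> : form3 p q t a c i - form3 p q t a c i' = (q * t - p) * (i'%:Z - i%:Z).
  by rewrite /form3; ring.
by apply: mulr_gt0; rewrite // subr_gt0 ltz_nat.
Qed.

Variables (n : nat) (G : 'I_n -> gen).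
Hypothesis cover : forall x : gen, exists e : 'I_n -> nat,
  [/\ ls_c x = ls_c (ls_prod G e), ls_form2 x = ls_form2 (ls_prod G e),
      ls_form3 x = ls_form3 (ls_prod G e) & ls_form4 x = ls_form4 (ls_prod G e)].

Local Notation span := (cox_span u (fun i => ls_divisor (G i)) (fun i => (ls_pol (G i))%:F)).

Lemma span_monomial (y : gen) (e : 'I_n -> nat) a mu (m : 'X_{1..2}) (l : k) :
    y = ls_prod G e -> ls_mult y = mu ->
    (forall i, a i = ls_bd y i - pairing (u i) m) ->
  span (laurent_divisor k a mu) (l *: ('X_[m] * ls_pol y))%:F.
Proof.
move=> def_y emu ea; have X0 : 'X_[m] != 0 :> pol by rewrite -msize_poly_eq0 msizeX.
have -> : (l *: ('X_[m] * ls_pol y))%:F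
    = l%:MP%:F * ('X_[m]%:F * \prod_i (ls_pol (G i))%:F ^+ e i).
  rewrite -mul_mpolyC !tofracM def_y ls_pol_prod rmorph_prod; congr (_ * (_ * _)).
  by apply: eq_bigr => i _; rewrite rmorphXn.
apply: cox_span_monomial; split; first by rewrite tofrac_eq0.
move=> P; rewrite coeff_ls_divisor_prod -def_y (ord_tofrac _ _ X0) ord_polX.
case: P => [[i|[]]|c].
- by rewrite !coeff_laurent_boundary ea /= subrK.
- by rewrite !coeff_laurent_exceptional emu /= addr0.
by rewrite !coeff_laurent_curve /= addr0.
Qed.

(** After the subtraction either [c] has grown and [descent_form] drops, or [c] is unchanged, [i]
    has grown and [form3] drops while [descent_form] stays. Both are nonnegative on sections and
    invariant under monomials, so the double induction closes. *)
Lemma cover_span (x : gen) : span (ls_divisor x) (ls_pol x)%:F.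
Proof.
have [N1] := ubnP `|descent_form (ls_bd x) (ls_c x) (ls_i x)|%N.
elim: N1 x => // N1 IH1 x; have [N3] := ubnP `|ls_form3 x|%N.
elim: N3 x => // N3 IH3 x le3 le1.
have [e [ec e2 e3 e4]] := cover x; pose y := ls_prod G e.
have [m1 [m2 [ebd emu ei]]] := ls_translate q_gt0 r_gt0 ec e2 e3 e4.
pose a i := ls_bd x i - pairing (u i) m1.
have X0 m : 'X_[m] != 0 :> pol by rewrite -msize_poly_eq0 msizeX.
pose f1 := 'X_[m1] * ls_pol x; pose l := ls_coef x / ls_coef y.
pose g1 := l *: ('X_[m2] * ls_pol y).
have l0 : l != 0 by rewrite mulf_neq0 ?invr_eq0 ?ls_coef_neq0.
have f1_sec : laurent_section u a (ls_mult x) f1.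
  have := laurent_sectionM (laurent_sectionX k u m1) (ls_sectionP x).
  by rewrite add0r (_ : (fun i => _) = a) //; apply/funext => i; rewrite addrC.
have g1_sec : laurent_section u a (ls_mult x) g1.
  apply: laurent_sectionZ l0 _.
  have := laurent_sectionM (laurent_sectionX k u m2) (ls_sectionP y).
  rewrite add0r emu (_ : (fun i => _) = a) //; apply/funext => i.
  by rewrite addrC /a ebd.
have f1_low : lowest_term f1 (ls_c x) (m1 ord0 + ls_i x) (ls_coef x).
  by have := lowest_termM (lowest_term_mon k m1) (ls_lowestP x); rewrite mul1r.
have g1_low : lowest_term g1 (ls_c x) (m1 ord0 + ls_i x) (ls_coef x).
  have := lowest_termM (lowest_termC l) (lowest_termM (lowest_term_mon k m2) (ls_lowestP y)).
  by rewrite mul_mpolyC mul1r !add0n -ei -/y -ec divfK ?ls_coef_neq0.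
have span_g1 : span (laurent_divisor k a (ls_mult x)) g1%:F.
  by apply: (@span_monomial y e) => //; rewrite -emu.
have span_f1 : span (laurent_divisor k a (ls_mult x)) f1%:F.
  have [/eqP fg0|fg0] := eqVneq (f1 - g1) 0.
    by move: fg0; rewrite subr_eq0 => /eqP ->.
  rewrite -[f1](subrK g1) tofracD; apply: cox_spanD span_g1.
  have [c' [i' [l' [l'0 low lex]]]] := lowest_termB f1_low g1_low fg0.
  pose z : gen := LeadSection (laurent_sectionB fg0 f1_sec g1_sec) low l'0.
  have [bx2 bx3 _] := ls_bounds q_gt0 r_gt0 x; have [bz2 bz3 _] := ls_bounds q_gt0 r_gt0 z.
  have pos b c j : 0 <= form2 p q b c j -> 0 <= form3 p q t b c j ->
      0 <= descent_form b c j.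
    by move=> ? ?; rewrite addr_ge0 // mulr_ge0 // ltW.
  have Mx : descent_form (ls_bd x) (ls_c x) (ls_i x)
      = descent_form a (ls_c x) (m1 ord0 + ls_i x).
    by rewrite /descent_form form2_shift form3_shift.
  have x3 : ls_form3 x = form3 p q t a (ls_c x) (m1 ord0 + ls_i x).
    by rewrite form3_shift.
  have Mx0 := pos _ _ _ bx2 bx3; have Mz0 := pos _ _ _ bz2 bz3.
  case: lex => [lt_c|[ec' lt_i]].
    apply: (IH1 z); have := descent_form_lt a (m1 ord0 + ls_i x) i' lt_c.
    rewrite -Mx; move: Mx0 Mz0 le1; rewrite /= /ls_bd /= -/a; lia.
  have lt3 : ls_form3 z < ls_form3 x by rewrite x3 /ls_form3 /= ec'; apply: form3_lt.
  apply: (IH3 z); first by move: lt3 bx3 bz3 le3; lia.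
  by move: le1; rewrite Mx /= ec' (descent_form_indep _ _ _ i').
have H0 : 'X_[m1]%:F != 0 :> {fraction pol} by rewrite tofrac_eq0.
apply: (@cox_span_shift _ _ _ _ _ _ (laurent_divisor k a (ls_mult x)) 'X_[m1]%:F) => //.
  move=> P; rewrite (ord_tofrac _ _ (X0 m1)) ord_polX; case: P => [[i|[]]|c].
  - by rewrite !coeff_laurent_boundary.
  - by rewrite !coeff_laurent_exceptional /= subr0.
  by rewrite !coeff_laurent_curve /= subr0.
by rewrite mulrC -tofracM.
Qed.

End Descent.

(** * The four rays and finite generation *)

Section FiniteGeneration.

Variable k : closedFieldType.
Local Notation pol := {mpoly k[2]}.
Local Notation ratfun := {fraction pol}.
Local Notation "x %:F" := (tofrac x).

Variables (p q r t : nat).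

Let u := tri_fan p q t.
Local Notation gen := (lead_section k p q t).

Lemma laurent_section_supp a (mu : int) (f : pol) : f != 0 ->
    (forall i m, m \in msupp f -> 0 <= pairing (u i) m + a i) ->
    mu <= (mult_e f)%:Z ->
  laurent_section u a mu f.
Proof.
move=> f0 fa fm; split=> // i; rewrite -lerBlDr.
apply: (@le_min_weight _ (pairing (u i))) => // m mf.
by rewrite lerBlDr fa.
Qed.

Definition bd3 (a b c : int) (i : 'I_3) : int :=
  match val i with 0 => a | 1 => b | _ => c end.

(** The value -1 of [mu] stands for the divisor E, whose canonical section is 1. *)
Lemma exceptional_section : laurent_section u (fun=> 0) (-1) (1 : pol).
Proof. by have [f0 fa _] := laurent_section1 k u; split. Qed.

Lemma supp_const (m : 'X_{1..2}) : m \in msupp (1 : pol) -> m = 0%MM.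
Proof. by rewrite msupp1 inE => /eqP. Qed.

Lemma base_section : laurent_section u (bd3 1 0 0) 0 (1 : pol).
Proof.
apply: laurent_section_supp => [||//]; first exact: oner_neq0.
move=> i m /supp_const ->; case: (ord3P i) => ->;
  by rewrite /pairing /u /tri_fan /bd3 /= !mnm0E; lia.
Qed.

Definition curve_C : pol := 1 - 'X_ord_max.

Lemma phi_curve_C : phi curve_C = - 'X.
Proof.
rewrite /curve_C raddfB /=.
have -> : phi (1 : pol) = 1 by rewrite rmorph1.
by rewrite /phi /= psiXU /psi_var /= comp_polyX; ring.
Qed.

Lemma curve_C_neq0 : curve_C != 0.
Proof. by rewrite -phi_eq0 phi_curve_C oppr_eq0 polyX_eq0. Qed.

Lemma lowest_term_curve_C : lowest_term curve_C 1 0 (-1).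
Proof.
exists (-1)%:P, 0; rewrite phi_curve_C hornerC expr0 expr1 mul1r mulr0 addr0; split=> //.
by rewrite !polyCN mulrN mulr1.
Qed.

(** Along the three boundary divisors 1 - y has orders 0, -q and 0, whence the class q D_1 - E of
    C. *)
Lemma curve_C_section : laurent_section u (bd3 0 q%:Z 0) 1 curve_C.
Proof.
apply: laurent_section_supp; first exact: curve_C_neq0.
  move=> i m /msuppB_le; rewrite mem_cat => /orP[/supp_const ->|].
    by case: (ord3P i) => ->; rewrite /pairing /u /tri_fan /bd3 /= !mnm0E; lia.
  rewrite msuppX inE => /eqP ->.
  by case: (ord3P i) => ->; rewrite /pairing /u /tri_fan /bd3 /= !mnm1E /=; lia.
rewrite lez_nat; apply: le_mult_e => [|i c]; first exact: curve_C_neq0.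
case: i c => [|i] [|c] //; rewrite phi_curve_C coefN coefX /= oppr0.
by rewrite comp_poly0 coef0.
Qed.

Lemma N1_neq0 : -1 != 0 :> k.
Proof. by rewrite oppr_eq0 oner_neq0. Qed.

Definition gen_exceptional : gen :=
  LeadSection exceptional_section (lowest_term1 k) (oner_neq0 k).
Definition gen_base : gen := LeadSection base_section (lowest_term1 k) (oner_neq0 k).
Definition gen_C : gen :=
  LeadSection curve_C_section lowest_term_curve_C N1_neq0.

(** Products of this shape suffice for the descent: arbitrary powers of the four ray generators
    times one element of the Dickson basis. *)
Lemma ls_additive_split (h : gen -> int) (g4 : 'I_4 -> gen) (n : nat) (g : 'I_n -> gen)
    (e4 : 'I_4 -> nat) (j0 : 'I_n) :
    h (ls1 k p q t) = 0 -> (forall x y, h (lsM x y) = h x + h y) ->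
  h (ls_prod (fun j => match split j with inl i => g4 i | inr i => g i end)
       (fun j : 'I_(4 + n) => match split j with inl i => e4 i | inr i => (i == j0) end))
  = \sum_i (e4 i)%:Z * h (g4 i) + h (g j0).
Proof.
move=> h1 hM; rewrite (ls_additive_prod h1 hM) big_split_ord /=; congr (_ + _).
  by apply: eq_bigr => i _; rewrite (unsplitK (inl _ i)).
rewrite (bigD1 j0) //= big1 ?addr0 => [|i /negPf ni].
  by rewrite (unsplitK (inr _ j0)) eqxx mul1r.
by rewrite (unsplitK (inr _ i)) ni mul0r.
Qed.

Definition nth4 (T : Type) (a b c d : T) (i : 'I_4) : T :=
  match val i with 0 => a | 1 => b | 2 => c | _ => d end.

Lemma sum_nth4 (a b c d : nat) (x y z w : gen) (h : gen -> int) :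
  \sum_i (nth4 a b c d i)%:Z * h (nth4 x y z w i)
  = a%:Z * h x + b%:Z * h y + c%:Z * h z + d%:Z * h w.
Proof. by rewrite !big_ord_recl big_ord0 /= addr0 !addrA. Qed.

Hypothesis char0 : [pchar k] =i pred0.
Hypotheses (p_gt0 : (0 < p)%N) (q_gt0 : (0 < q)%N) (r_gt0 : (0 < r)%N).
Hypotheses (qt_eq : (q * t = p + r)%N) (area_le : (q * (p + r) <= p * r)%N).

Theorem mori_dream_space_tri_fan : mori_dream_space k u.
Proof.
have p0 : 0 < p%:Z by lia.
have q0 : 0 < q%:Z by lia.
have rE : q%:Z * t%:Z - p%:Z = r by lia.
have r0 : 0 < q%:Z * t%:Z - p%:Z by rewrite rE; lia.
pose m := (q * (p + r))%N.
have [F [F0 Fsupp Fm [l l0 Fl]]] := exists_apex_curve char0 p_gt0 q_gt0 r_gt0 qt_eq area_le.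
(* The base and the left edge pass through the origin; the right edge y = t (x - q r) contributes t
   q r. *)
have F_sec : laurent_section u (bd3 0 0 (t * (q * r))%N) m F.
  apply: laurent_section_supp => // i mo /Fsupp[F1 F2].
  case: (ord3P i) => ->; rewrite /pairing /u /tri_fan /bd3 /=; first by lia.
    by nia.
  by nia.
pose gF : gen := LeadSection F_sec Fl l0.
pose Gamma l1 l2 l3 l4 := exists x : gen, [/\ ls_c x = l1, ls_form2 x = l2%:Z,
  ls_form3 x = l3%:Z & ls_form4 x = l4%:Z].
have rmE : (r * m)%N = (q * (t * (q * r)))%N :> int by rewrite /m -qt_eq !PoszM; ring.
have rm0 : (0 < r * m)%N by rewrite !muln_gt0 r_gt0 q_gt0 addn_gt0 p_gt0.
(* In the coordinates [c], [form2], [form3], [form4] the sections of C, the base, F and E are (1, 0,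
   0, 0), (0, q, 0, 0), (0, 0, r m, 0) and (0, 0, 0, r). These entries are the four step sizes. *)
have [s [sP sR]] := dickson4 Gamma (ltn0Sn 0) q_gt0 rm0 r_gt0.
have [g gP] : exists g : 'I_(size s) -> gen, forall j : 'I_(size s),
    let y := nth (0, 0, 0, 0)%N s j in
    [/\ ls_c (g j) = y.1.1.1, ls_form2 (g j) = y.1.1.2%:Z,
        ls_form3 (g j) = y.1.2%:Z & ls_form4 (g j) = y.2%:Z].
  suff /choice[g gP] : forall j : 'I_(size s), exists x : gen,
      let y := nth (0, 0, 0, 0)%N s j in
      [/\ ls_c x = y.1.1.1, ls_form2 x = y.1.1.2%:Z,
          ls_form3 x = y.1.2%:Z & ls_form4 x = y.2%:Z] by exists g.
  by move=> j; apply: sP; apply: mem_nth.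
pose g4 := nth4 gen_exceptional gen_C gen_base gF.
pose G (j : 'I_(4 + size s)) := match split j with inl i => g4 i | inr i => g i end.
exists (4 + size s)%N, (fun i => ls_divisor (G i)), (fun i => tofrac (ls_pol (G i))).
have span : forall x : gen, cox_span u (fun i => ls_divisor (G i))
    (fun i => tofrac (ls_pol (G i))) (ls_divisor x) (tofrac (ls_pol x)).
  apply: (cover_span p0 q0 r0) => x.
  have [b2 b3 b4] := ls_bounds q0 r0 x.
  have [|y ys [n1 [n2 [n3 [n4 [e1 e2 e3 e4]]]]]] :=
      sR (ls_c x) `|ls_form2 x|%N `|ls_form3 x|%N `|ls_form4 x|%N.
    by exists x; rewrite !gez0_abs.
  have lt_j : (index y s < size s)%N by rewrite index_mem.
  pose j0 := Ordinal lt_j; have := gP j0; rewrite /= nth_index // => -[g1 g2 g3 g4'].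
  (* The exponents follow the order of [g4], in which E comes first. *)
  exists (fun j => match split j with
    inl i => nth4 n4 n1 n2 n3 i | inr i => (i == j0) end).
  have splitE h h1 hM :=
    etrans (@ls_additive_split h g4 _ g (nth4 n4 n1 n2 n3) j0 h1 hM)
      (congr1 (+%R^~ (h (g j0)))
        (sum_nth4 n4 n1 n2 n3 gen_exceptional gen_C gen_base gF h)).
  split.
  - apply/eqP; rewrite -eqz_nat; apply/eqP.
    rewrite [RHS](splitE (fun x => (ls_c x)%:Z)) // g1 e1 mul1n /gF /=; ring.
  - rewrite [RHS](splitE _ (ls_form2_1 k p q t) (@ls_form2M k p q t)) g2.
    rewrite -[LHS]gez0_abs // e2 /ls_form2 /form2 /bd3 /=; ring.
  - rewrite [RHS](splitE _ (ls_form3_1 k p q t) (@ls_form3M k p q t)) g3.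
    rewrite -[LHS]gez0_abs // e3 PoszD PoszM rmE /ls_form3 /form3 /bd3 /= !PoszM; ring.
  rewrite [RHS](splitE _ (ls_form4_1 k p q t) (@ls_form4M k p q t)) g4'.
  rewrite -[LHS]gez0_abs // e4 PoszD PoszM /ls_form4 /form4 /bd3 /= rE.
  have -> : q%:Z * (t * (q * r))%N%:Z = r%:Z * m%:Z by rewrite -PoszM -rmE PoszM.
  ring.
apply: cox_generated_by_laurent => [i|a mu f f_sec].
  exact: laurent_global_section (ls_sectionP (G i)).
have [f0 _ _] := f_sec; have [c [i [l' [l'0 low]]]] := lowest_term_exists f0.
exact: span (LeadSection f_sec low l'0).
Qed.

End FiniteGeneration.

(** * The self-intersection of C *)

Section SelfIntersection.

Variable k : closedFieldType.
Local Notation pol := {mpoly k[2]}.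

Lemma coef_curve_C0 : (curve_C k)@_0%MM = 1.
Proof. by rewrite mcoeffB mcoeff1 eqxx mcoeffX mnm1_eq0 subr0. Qed.

Lemma coef_curve_C1 : (curve_C k)@_U_(ord_max)%MM = -1.
Proof. by rewrite mcoeffB mcoeff1 mnm1_eq0 mcoeffX eqxx sub0r. Qed.

Lemma ord_boundary_curve_C (v : int * int) :
  ord_boundary v (curve_C k) = Num.min 0 v.2.
Proof.
have p0 : pairing v 0%MM = 0 by rewrite /pairing !mnm0E !mulr0.
have p1 : pairing v U_(ord_max)%MM = v.2 by rewrite /pairing !mnm1E /= mulr0 mulr1 add0r.
apply/eqP; rewrite eq_le; apply/andP; split.
  rewrite le_min -{1}p0 -p1 !ord_boundary_le // mcoeff_msupp.
    by rewrite coef_curve_C1 oppr_eq0 oner_neq0.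
  by rewrite coef_curve_C0 oner_neq0.
apply: (@le_min_weight _ (pairing v)); first exact: curve_C_neq0.
move=> m /msuppB_le; rewrite mem_cat => /orP[/supp_const ->|].
  by rewrite p0 ge_min lexx.
by rewrite msuppX inE => /eqP ->; rewrite p1 ge_min lexx orbT.
Qed.

Lemma mult_e_curve_C : mult_e (curve_C k) = 1%N.
Proof.
have [_ _] := curve_C_section k 0 1 0; rewrite lez_nat => le1.
apply/eqP; rewrite eqn_leq le1 andbT leqNgt; apply/negP => /(@coef_mult_e _ _ 0 1).
rewrite phi_curve_C coefN coefX /= -polyCN comp_polyC coefC /= => /eqP.
by rewrite oppr_eq0 oner_eq0.
Qed.

(** The constant term of 1 - y is nonzero, so the monomial factor is trivial. *)
Lemma defines_curve_C (c : torus_curve k) : defines_curve (curve_C k) c ->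
  exists2 a : k, a != 0 & curve_C k = a *: val c.
Proof.
move=> [a [m [a0 def_C]]]; exists a => //.
suff m0 : m = 0%MM by rewrite def_C m0 mpolyX0 mul1r.
apply/eqP; apply: contraTT (oner_neq0 k) => m0; rewrite negbK -coef_curve_C0 def_C.
rewrite mcoeffZ mulrC mcoeffM big1 ?mulr0 ?mul0r //.
move=> [m1 m2] /=; rewrite eq_sym mnmD_eq0 => /andP[/eqP -> _].
by rewrite mcoeffX (negPf m0) mul0r.
Qed.

Lemma boundary_coefU (u : 'I_3 -> int * int) i (c : torus_curve k) :
  boundary_coef u i << closure_of c >> = - ord_boundary (u i) (val c).
Proof. by rewrite /boundary_coef domU1 big_seq1 coeffU eqxx mulr1 mul1r. Qed.

Lemma exceptional_coefU (c : torus_curve k) :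
  exceptional_coef << closure_of c >> = - (mult_e (val c))%:Z.
Proof. by rewrite /exceptional_coef domU1 big_seq1 coeffU eqxx mulr1 mul1r. Qed.

(** The class of C is q D_1 - E and D_1 . D_1 = t / (p r), so that C . C = q^2 t / (p r) - 1. *)
Lemma negative_curve_C (p q t r : nat) (c : torus_curve k) :
    (0 < p)%N -> (0 < q)%N -> (0 < r)%N -> (q * t = p + r)%N ->
    defines_curve (curve_C k) c -> negative_curve (tri_fan p q t) (closure_of c) ->
  (q * (p + r) <= p * r)%N.
Proof.
move=> p0 q0 r0 qt /defines_curve_C[a a0 def_C] [_].
have t0 : (0 < t)%N by case: (t) qt => //; lia.
have ordE v : ord_boundary v (val c) = Num.min 0 v.2.
  rewrite -ord_boundary_curve_C def_C -mul_mpolyC ord_boundaryM ?mpolyC_eq0 ?curve_neq0 //.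
  by rewrite ord_boundaryC // add0r.
have multE : mult_e (val c) = 1%N.
  have := mult_e_curve_C; rewrite def_C -mul_mpolyC mult_eM ?mpolyC_eq0 ?curve_neq0 //.
  by rewrite mult_eC.
rewrite /intersection exceptional_coefU multE.
have bc i : boundary_coef (tri_fan p q t) i << closure_of c >> = if i == o1 then q%:Z else 0.
  rewrite boundary_coefU ordE; case: (ord3P i) => -> /=; rewrite /Order.min.
  - by [].
  - by rewrite /=; case: ifP; rewrite ?opprK // => /negP; lia.
  by [].
rewrite (bigD1 o1) //= (bigD1 o1) //= !bc /=.
rewrite big1 => [|i /negPf ni]; last by rewrite bc ni mulr0 mul0r.
rewrite big1 => [|i /negPf ni]; last by rewrite big1 // => j _; rewrite bc ni mul0r mul0r.
rewrite !addr0.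
have weightE i (n : nat) : `|det2 (tri_fan p q t (i + 1)) (tri_fan p q t (i - 1))| = n%:Z ->
    ray_weight (tri_fan p q t) i = n%:R by rewrite /ray_weight => ->; rewrite -pmulrn.
have w0 : ray_weight (tri_fan p q t) o0 = r%:R.
  apply: weightE; rewrite /tri_fan /det2 /= mulr1 mulrNN -PoszM qt PoszD opprD addNKr.
  by rewrite normrN.
have w1 : ray_weight (tri_fan p q t) o1 = t%:R.
  by apply: weightE; rewrite /tri_fan /det2 /= mulr1 mulr0 subr0 normrN.
have w2 : ray_weight (tri_fan p q t) o2 = p%:R.
  by apply: weightE; rewrite /tri_fan /det2 /= mul0r mul1r sub0r normrN.
rewrite /boundary_dot !big_ord_recl big_ord0.
have -> : ord0 = o0 by exact: val_inj.
have -> : fintype.lift o0 ord0 = o1 by exact: val_inj.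
have -> : fintype.lift o0 (fintype.lift ord0 ord0) = o2 by exact: val_inj.
rewrite w0 w1 w2 -pmulrn mulr1 rmorphN /= mulrNN mulr1 subr_le0.
rewrite [X in X <= _ -> _](_ : _ = (q * q * t)%N%:R / (p * r)%N%:R); last first.
  rewrite !natrM; field.
  by rewrite !pnatr_eq0 -!lt0n p0 r0 t0.
rewrite ler_pdivrMr ?ltr0n ?muln_gt0 ?p0 // mul1r ler_nat.
by rewrite -qt mulnA.
Qed.

End SelfIntersection.

Theorem lemma6p2 (k : closedFieldType) (char0 : [pchar k] =i pred0)
    (Delta : triangle)
    (supp : supports_negative_curve Delta (1 - 'X_ord_max : {mpoly k[2]}))
    (t_int : right_slope Delta \is a Num.int) :
  mori_dream_space k (normal_fan Delta).
Proof.
have [[c def_c neg_c] _ _] := supp.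
have s0 := left_slope_gt0 Delta; have st := left_lt_right Delta.
have nums0 : 0 < numq (left_slope Delta) by rewrite numq_gt0.
have dens0 : 0 < denq (left_slope Delta) by exact: denq_gt0.
have numt0 : 0 < numq (right_slope Delta) by rewrite numq_gt0 (lt_trans s0).
have dent : denq (right_slope Delta) = 1.
  by move: t_int; rewrite Qint_def => /eqP.
pose p := `|numq (left_slope Delta)|%N; pose q := `|denq (left_slope Delta)|%N.
pose t := `|numq (right_slope Delta)|%N.
have pE : numq (left_slope Delta) = p by rewrite /p gtz0_abs.
have qE : denq (left_slope Delta) = q by rewrite /q gtz0_abs.
have tE : numq (right_slope Delta) = t by rewrite /t gtz0_abs.
have fanE : normal_fan Delta = tri_fan p q t.
  apply/funext => i; case: (ord3P i) => ->; rewrite /normal_fan /tri_fan /=.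
  - by [].
  - by rewrite pE qE.
  by rewrite tE dent.
have lt_pqt : (p < q * t)%N.
  move: st; rewrite -[left_slope Delta]divq_num_den -[right_slope Delta]divq_num_den.
  rewrite pE qE tE dent divr1 ltr_pdivrMr ?ltr0z -?qE //.
  by rewrite -rmorphM /= ltr_int qE -PoszM ltz_nat mulnC.
(* Up to sign, the determinant of the normals of the two slanted edges; it is positive because s <
   t. *)
pose r := (q * t - p)%N.
have qt : (q * t = p + r)%N by rewrite /r subnKC // ltnW.
have p0 : (0 < p)%N by rewrite -ltz_nat -pE.
have q0 : (0 < q)%N by rewrite -ltz_nat -qE.
have r0 : (0 < r)%N by rewrite subn_gt0.
rewrite fanE; rewrite fanE in neg_c.
exact: (mori_dream_space_tri_fan char0 p0 q0 r0 qt (negative_curve_C p0 q0 r0 qt def_c neg_c)).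
Qed.
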